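(* Let $X$ be a weakly compactly generated Banach space. (a) If $X$ is nonseparable, then $K(X,c_0)=\infty$. (b) If $X$ is a $\mathcal K$-space, then $K_0(X,c_0)<\infty$. Therefore, if $X$ is a nonseparable weakly compactly generated Banach $\mathcal K$-space, then $K_0(X,c_0)$ is finite but $K(X,c_0)$ is not.
   Context: Scalars are real or complex, with scalar field $\mathbb K$. $c_0$ is the Banach space of all null sequences of scalars with the sup norm. A Banach space is weakly compactly generated (WCG) if it contains a weakly compact subset whose linear span is dense in the whole space. A map $F:X\to Y$ between quasi-Banach spaces is homogeneous if $F(\lambda x)=\lambda F(x)$ for all scalars $\lambda$ and $x\in X$; a homogeneous map is bounded if $\|F\|:=\sup_{\|x\|\le1}\|F(x)\|<\infty$. $F$ is quasilinear if it is homogeneous and there is a constant $Q$ with $\|F(x+y)-F(x)-F(y)\|_Y\le Q(\|x\|_X+\|y\|_X)$ for all $x,y\in X$; the least such $Q$ is denoted $Q(F)$. $K_0(X,Y)$ is the infimum of those constants $C$ for which the following holds: if $F:X\to Y$ is a bounded quasilinear map, then there is a linear (not necessarily continuous) map $L:X\to Y$ such that $\|F-L\|\le C\,Q(F)$. $K(X,Y)$ is defined in the same way omitting the word ''bounded''. (The value is $\infty$ if there is no such $C$.) A quasi-Banach space $X$ is a $\mathcal K$-space if $K(X,\mathbb K)<\infty$; equivalently, every quasilinear function $X\to\mathbb K$ is the sum of a linear map and a bounded homogeneous map. *)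

(* Defs.v *)
From HB Require Import structures.
From mathcomp Require Import all_boot all_order all_algebra.
From mathcomp Require Import complex.
From mathcomp Require Import all_classical all_reals all_analysis.
Set Implicit Arguments.
Unset Strict Implicit.
Unset Printing Implicit Defensive.
Import Order.TTheory GRing.Theory Num.Theory.
Import numFieldNormedType.Exports.
Local Open Scope classical_set_scope.
Local Open Scope ring_scope.

Variant scalars := RealScalars | ComplexScalars.

Definition scalar_field (R : realType) (s : scalars) : numFieldType :=
  match s with
  | RealScalars => R
  | ComplexScalars => (R[i])%C
  end.

Definition real_part (R : realType) (s : scalars) : scalar_field R s -> R :=
  match s return scalar_field R s -> R with
  | RealScalars => fun x => x
  | ComplexScalars => fun z => complex.Re z
  end.

Definition of_real (R : realType) (s : scalars) : R -> scalar_field R s :=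
  match s return R -> scalar_field R s with
  | RealScalars => fun x => x
  | ComplexScalars => fun x => Complex x 0
  end.

(* Over K = scalar_field R s the library norm of a normedModType K takes its
   values in K; real_norm is the same number seen in R. *)
Definition real_norm (R : realType) (s : scalars)
  (V : normedModType (scalar_field R s)) (x : V) : R := real_part `|x|.

Section real_part_lemmas.
Context {R : realType} {s : scalars}.
Local Notation K := (scalar_field R s).
Implicit Types (x y : K) (a b : R).

Lemma of_realK a : real_part (of_real s a) = a.
Proof. by case: s. Qed.

Lemma real_partK x : 0 <= x -> of_real s (real_part x) = x.
Proof.
by case: s x => //= -[a b]; rewrite lecE /= => /andP[/eqP -> _].
Qed.

Lemma of_real0 : of_real s 0 = 0 :> K.
Proof. by case: s. Qed.

Lemma of_realD a b : of_real s (a + b) = of_real s a + of_real s b.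
Proof. by case: s => //=; rewrite -[RHS]/(Complex _ _) /= addr0. Qed.

Lemma of_realM a b : of_real s (a * b) = of_real s a * of_real s b.
Proof.
case: s => //=; apply/eqP.
by rewrite eq_complex /= !(mulr0, mul0r) subr0 addr0 !eqxx.
Qed.

Lemma ler_of_real a b : (of_real s a <= of_real s b) = (a <= b).
Proof. by case: s => //=; rewrite lecE /= eqxx. Qed.

Lemma ltr_of_real a b : (of_real s a < of_real s b) = (a < b).
Proof. by case: s => //=; rewrite ltcE /= eqxx. Qed.

Lemma real_partD x y : real_part (x + y) = real_part x + real_part y.
Proof. by case: s x y => //= -[? ?] [? ?]. Qed.

Lemma le_real_part x y : x <= y -> real_part x <= real_part y.
Proof. by case: s x y => //= -[? ?] [? ?]; rewrite lecE /= => /andP[]. Qed.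

Lemma real_part_ge0 x : 0 <= x -> 0 <= real_part x.
Proof. by move=> x0; rewrite -ler_of_real of_real0 real_partK. Qed.

Lemma real_part_normM x y :
  real_part `|x * y| = real_part `|x| * real_part `|y|.
Proof.
by rewrite normrM -{1}(real_partK (normr_ge0 x)) -{1}(real_partK (normr_ge0 y))
  -of_realM of_realK.
Qed.

Lemma real_part_norm_eq0 x : real_part `|x| = 0 -> x = 0.
Proof.
move=> x0; apply/eqP; rewrite -normr_eq0 -(real_partK (normr_ge0 x)) x0.
by rewrite of_real0.
Qed.

End real_part_lemmas.

Section null_sequences.
Variables (R : realType) (s : scalars).
Local Notation K := (scalar_field R s).

Definition null_seq : {pred nat -> K} :=
  [pred u : nat -> K | `[< (u : nat -> K^o) @ \oo --> (0 : K^o) >]].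

Lemma null_seqP (u : nat -> K) :
  reflect ((u : nat -> K^o) @ \oo --> (0 : K^o)) (u \in null_seq).
Proof. exact: asboolP. Qed.

Lemma null_seq_submod_closed : submod_closed null_seq.
Proof.
split; first by apply/null_seqP; exact: (@cvg_cst K^o).
move=> a u v /null_seqP u0 /null_seqP v0; apply/null_seqP.
have -> : (0 : K^o) = a *: (0 : K^o) + 0 by rewrite scaler0 addr0.
by apply: (@cvgD K K^o); [exact: (@cvgZl_tmp K K^o)|].
Qed.

HB.instance Definition _ :=
  GRing.isSubmodClosed.Build K (nat -> K) null_seq null_seq_submod_closed.

Record c0 : Type := C0 { c0_val :> nat -> K ; c0_valP : c0_val \in null_seq }.

HB.instance Definition _ := [isSub for c0_val].
HB.instance Definition _ := [Choice of c0 by <:].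
HB.instance Definition _ := [SubChoice_isSubLmodule of c0 by <:].

Definition c0_sup (u : c0) : R := sup [set real_part `|u n| | n in [set: nat]].

Definition c0_norm (u : c0) : K := of_real s (c0_sup u).

Lemma c0_bounded (u : c0) :
  has_sup [set real_part `|u n| | n in [set: nat]].
Proof.
split; first by exists (real_part `|u 0%N|); exists 0%N.
have /null_seqP u0 : c0_val u \in null_seq by exact: c0_valP.
have [N _ uN] : \forall n \near \oo, `|(u n : K^o)| <= 1.
  move/cvgrPdist_le : u0 => /(_ 1 ltr01); apply: filterS => n.
  by rewrite sub0r normrN.
exists (1 + \sum_(i < N) real_part `|u i|) => _ [n _ <-].
have ge0 i : 0 <= real_part `|u i| by exact/real_part_ge0.
have [nN|Nn] := ltnP n N; last first.
  apply: (@le_trans _ _ 1); last by rewrite lerDl sumr_ge0.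
  rewrite -(@ler_of_real _ s) real_partK//.
  suff -> : of_real s 1 = 1 :> K by exact: uN.
  by case: (s).
by rewrite (bigD1 (Ordinal nN))//= addrCA lerDl addr_ge0// sumr_ge0//.
Qed.

Lemma c0_sup_ub (u : c0) n : real_part `|u n| <= c0_sup u.
Proof. by apply: sup_upper_bound; [exact: c0_bounded|exists n]. Qed.

Lemma c0_sup_le (u : c0) (M : R) :
  (forall n, real_part `|u n| <= M) -> c0_sup u <= M.
Proof.
move=> uM; apply: ge_sup; first by exists (real_part `|u 0%N|), 0%N.
by move=> _ [n _ <-].
Qed.

Lemma c0_normD (u v : c0) : c0_norm (u + v) <= c0_norm u + c0_norm v.
Proof.
rewrite /c0_norm -of_realD ler_of_real; apply: c0_sup_le => n.
apply: (le_trans (le_real_part (ler_normD (u n) (v n)))).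
by rewrite real_partD lerD// c0_sup_ub.
Qed.

Lemma c0_normZ (l : K) (u : c0) : c0_norm (l *: u) = `|l| * c0_norm u.
Proof.
rewrite -[`|l|](real_partK (normr_ge0 l)) /c0_norm -of_realM; congr of_real.
have lu n : real_part `|(l *: u) n| = real_part `|l| * real_part `|u n|.
  by rewrite -real_part_normM.
have l0 := real_part_ge0 (normr_ge0 l).
apply/eqP; rewrite eq_le; apply/andP; split.
  by apply: c0_sup_le => n; rewrite lu ler_wpM2l// c0_sup_ub.
have [->|ln0] := eqVneq (real_part `|l|) 0.
  by rewrite mul0r (le_trans _ (c0_sup_ub _ 0%N))// real_part_ge0.
have lgt0 : 0 < real_part `|l| by rewrite lt_neqAle eq_sym ln0.
rewrite -ler_pdivlMl//; apply: c0_sup_le => n.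
by rewrite ler_pdivlMl// -lu c0_sup_ub.
Qed.

Lemma c0_norm0_eq0 (u : c0) : c0_norm u = 0 -> u = 0.
Proof.
move=> /(congr1 (@real_part R s)); rewrite of_realK -(of_real0 (s:=s)) of_realK.
move=> u0; apply/val_inj/funext => n /=; apply: real_part_norm_eq0.
by apply/eqP; rewrite eq_le real_part_ge0// andbT -u0 c0_sup_ub.
Qed.

HB.instance Definition _ :=
  @Lmodule_isNormed.Build K c0 c0_norm c0_normD c0_normZ c0_norm0_eq0.

End null_sequences.

Section weak_compactness.
Variables (R : realType) (s : scalars).
Local Notation K := (scalar_field R s).
Variable X : normedModType K.

Definition continuous_dual : Type := {f : {linear X -> K^o} | continuous f}.

Definition weak_topology : topologicalType :=
  @sup_topology X continuous_dual
    (fun f => Topological.class (initial_topology (sval f : X -> K^o))).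

Definition weakly_compact (A : set X) : Prop := @compact weak_topology A.

Definition linear_span (A : set X) : set X :=
  [set v | exists (n : nat) (a : 'I_n -> K) (x : 'I_n -> X),
     (forall i, A (x i)) /\ v = \sum_(i < n) a i *: x i].

Definition weakly_compactly_generated : Prop :=
  exists A : set X, weakly_compact A /\ dense (linear_span A).

Definition separable_space : Prop := exists D : set X, countable D /\ dense D.

End weak_compactness.

Section quasilinear_maps.
Variables (R : realType) (s : scalars).
Local Notation K := (scalar_field R s).
Variables X Y : normedModType K.
Implicit Types (F : X -> Y) (Q C : R).

Definition homogeneous F : Prop :=
  forall (l : K) (x : X), F (l *: x) = l *: F x.

Definition map_norm F : \bar R :=
  ereal_sup [set (real_norm (F x))%:E | x in [set x : X | real_norm x <= 1]].

Definition bounded_map F : Prop := homogeneous F /\ (map_norm F < +oo)%E.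

Definition quasilinear_with F Q : Prop :=
  forall x y : X,
    real_norm (F (x + y) - F x - F y) <= Q * (real_norm x + real_norm y).

Definition quasilinear F : Prop :=
  homogeneous F /\ exists Q, quasilinear_with F Q.

(* The constraint 0 <= Q only matters on the zero space, where every real
   number is otherwise admissible. *)
Definition quasilinear_const F : R :=
  inf [set Q : R | 0 <= Q /\ quasilinear_with F Q].

Definition linearly_approximable C F : Prop :=
  exists L : {linear X -> Y},
    (map_norm (F \- L)%R <= (C * quasilinear_const F)%:E)%E.

(* As above, 0 <= C is only needed to exclude negative constants when every
   relevant F has quasilinearity constant 0. The infimum over the empty set
   is +oo. *)
Definition K_const : \bar R :=
  ereal_inf [set C%:E | C in [set C : R | 0 <= C /\
    forall F, quasilinear F -> linearly_approximable C F]].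

Definition K0_const : \bar R :=
  ereal_inf [set C%:E | C in [set C : R | 0 <= C /\
    forall F, bounded_map F -> quasilinear F -> linearly_approximable C F]].

End quasilinear_maps.

Definition K_space (R : realType) (s : scalars)
    (X : normedModType (scalar_field R s)) : Prop :=
  (K_const X (scalar_field R s)^o < +oo)%E.

(* Main.v *)
Require Import Defs.
From HB Require Import structures.
From mathcomp Require Import all_boot all_order all_algebra.
From mathcomp Require Import complex ring lra wochoice.
From mathcomp Require Import all_classical all_reals all_analysis.
Import Order.TTheory GRing.Theory Num.Theory.
Import numFieldNormedType.Exports.
Set Implicit Arguments.
Unset Strict Implicit.
Unset Printing Implicit Defensive.
Local Open Scope classical_set_scope.
Local Open Scope ring_scope.

(** Both parts rest on the fact that a sequence of continuous functionals
    cannot tell a weakly compact set [W] from a separable one: if a countable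
    subset [D] of [W] is dense in [W] for the pointwise topology of the
    sequence, then every point of [W] takes the same values as some point of
    the closed linear span of [D] ([weakly_compact_representative]). In
    particular a bounded operator from a weakly compactly generated space into
    the bounded sequences has a separable range, and a bounded sequence of
    functionals derived from the given one tends to zero everywhere if it does
    so on [D] ([null_on_generated]).

    Part (b). The coordinates of a bounded quasilinear map [F] into [c0] are
    uniformly close to linear functionals, because [X] is a K-space, and these
    form a bounded operator from [X] into the bounded sequences. This operator
    maps [x] at distance of order [Q(F) * real_norm x] from [c0]. Since its
    range is separable, it can be pushed into [c0] at the cost of a
    perturbation of norm of order [Q(F)], as in Veech's proof of Sobczyk's
    theorem ([null_correction], [K0_const_c0_finite]).

    Part (a). A nonseparable weakly compactly generated space carries an
    uncountable family of nonzero functionals of norm at most one, each vector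
    being small under all but finitely many of them
    ([small_uncountable_family]). Indexing them by branches of the dyadic
    tree, that is by almost disjoint sets of integers, gives an operator from
    [X] into the quotient of the bounded sequences by [c0] with a nonseparable
    range ([glued]). Composing a homogeneous bounded lifting of it with an
    algebraic projection onto [c0] produces a quasilinear map into [c0]. If a
    linear map were at finite distance from it, the operator would lift to a
    bounded operator into the bounded sequences, whose range would be
    separable ([K_const_c0_infinite]). *)

(** * Extension of linear maps *)

Lemma bundle_linear (k : pzRingType) (V Y : lmodType k) (f : V -> Y) :
  linear f -> exists g : {linear V -> Y}, forall x, g x = f x.
Proof.
move=> flin.
by exists (HB.pack_for {linear V -> Y} f (GRing.isLinear.Build _ _ _ _ _ flin)).
Qed.

Section linear_extension.
Variables (k : fieldType) (V Y : lmodType k).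
Implicit Types G P : set (V * Y).

(** A partial linear map is encoded by its graph, so that inclusion of graphs
    is extension of maps and unions of chains need no gluing. *)
Definition linear_graph G := [/\ G (0, 0),
  forall a p q, G p -> G q -> G (a *: p + q) &
  forall y, G (0, y) -> y = 0].

(** The common core of the Hahn-Banach theorem and of the existence of
    algebraic projections: Zorn's lemma reduces the extension of a linear map
    under a constraint [P] on its graph to the addition of one vector [v],
    whose value [y] must keep all the new pairs inside [P]. *)
Lemma linear_extension G0 P : linear_graph G0 -> G0 `<=` P ->
    (forall G, linear_graph G -> G `<=` P -> forall v,
      exists y, forall a p, G p -> P (a *: (v, y) + p)) ->
  exists L : {linear V -> Y},
    (forall v, P (v, L v)) /\ forall v y, G0 (v, y) -> L v = y.
Proof.
move=> G0lin G0P step.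
pose A := [set G | G = set0 \/ [/\ linear_graph G, G0 `<=` G & G `<=` P]].
have [F FA Ftot|G [AG Gmax]] := @Zorn_bigcup _ A.
  have [[G [FG G_neq0]]|F0] := pselect (exists G, F G /\ G <> set0); last first.
    left; rewrite -subset0 => p [G FG Gp]; apply: F0; exists G; split => //.
    by move=> GE; rewrite GE in Gp.
  have {FA}Fgraph H p : F H -> H p ->
      [/\ linear_graph H, G0 `<=` H & H `<=` P].
    by move=> /FA[->|].
  have [p Gp] : exists p, G p.
    by apply: contrapT => /forallNP G0'; apply: G_neq0; rewrite -subset0.
  have [[G00 _ _] G0G _] := Fgraph _ _ FG Gp.
  right; split; last 2 first.
  - by move=> q /G0G Gq; exists G.
  - by move=> q [H FH Hq]; have [_ _ HP] := Fgraph _ _ FH Hq; exact: HP.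
  split; first by exists G.
  - move=> a q r [H FH Hq] [H' FH' H'r].
    have [HH'|H'H] := Ftot _ _ FH FH'.
      exists H' => //; have [[_ lin _] _ _] := Fgraph _ _ FH' H'r.
      by apply: lin => //; exact: HH'.
    exists H => //; have [[_ lin _] _ _] := Fgraph _ _ FH Hq.
    by apply: lin => //; exact: H'H.
  - by move=> y [H FH H0y]; have [[_ _ H0] _ _] := Fgraph _ _ FH H0y; exact: H0.
have [Glin G0G GP] : [/\ linear_graph G, G0 `<=` G & G `<=` P].
  case: AG => // GE; exfalso; apply: (Gmax G0); last by right; split.
  split; rewrite GE; first exact: sub0set.
  by case: G0lin => G00 _ _ /(_ _ G00).
have [G00 Gl G0u] := Glin.
have Gtot v : exists y, G (v, y).
  apply: contrapT => vG; have [y yP] := step G Glin GP v.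
  pose H := [set q | exists a p, G p /\ q = a *: (v, y) + p].
  have GH : G `<=` H by move=> p Gp; exists 0, p; rewrite scale0r add0r.
  apply: (Gmax H).
    split => // /(_ (v, y)) Gvy; apply: vG; exists y; apply: Gvy.
    by exists 1, 0; split => //; rewrite scale1r addr0.
  right; split; first split.
  - exact: GH.
  - move=> a _ _ [b [p [Gp ->]]] [c [q [Gq ->]]].
    exists (a * b + c), (a *: p + q); split; first exact: Gl.
    by rewrite scalerDr scalerA addrACA scalerDl.
  - move=> z [a [[u w] [Guw]]] [/esym/eqP].
    have [->|a0] := eqVneq a 0.
      by rewrite !scale0r !add0r => /eqP u0 ->; rewrite u0 in Guw; exact: G0u.
    rewrite addr_eq0 => /eqP av _; exfalso; apply: vG.
    exists (- a^-1 *: w); have := Gl (- a^-1) _ _ Guw G00.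
    rewrite addr0; congr (G (_, _)).
    by rewrite /= -[u]opprK -av scalerN scaleNr opprK scalerA mulVf// scale1r.
  - exact: subset_trans GH.
  - by move=> _ [a [p [Gp ->]]]; exact: yP.
have [L GL] := choice Gtot.
have Guniq v y z : G (v, y) -> G (v, z) -> y = z.
  move=> Gy Gz; apply/eqP; rewrite eq_sym -subr_eq0; apply/eqP/G0u.
  have := Gl (-1) _ _ Gy Gz; congr (G (_, _)) => /=.
    by rewrite scaleN1r addNr.
  by rewrite scaleN1r addrC.
have Llin : linear L.
  move=> a u v; apply: (@Guniq (a *: u + v)) => //.
  exact: (Gl a _ _ (GL u) (GL v)).
have [L' L'E] := bundle_linear Llin.
exists L'; split => [v|v y /G0G Gvy]; rewrite L'E; first exact/GP/GL.
exact: (@Guniq v).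
Qed.

End linear_extension.

(** * The Hahn-Banach theorem *)

Section hahn_banach.
Variables (R : realType) (V : lmodType R) (p : V -> R).
Hypothesis pD : forall u v, p (u + v) <= p u + p v.
Hypothesis pZ : forall a v, 0 < a -> p (a *: v) = a * p v.

Let p0 : p 0 = 0.
Proof. by have := pZ 0 (ltr0Sn R 1); rewrite scaler0; lra. Qed.

Lemma sublinear_scale_ge a v : a * p v <= p (a *: v).
Proof.
have [a0|a0|<-] := ltgtP 0 a; first by rewrite pZ.
  have := pD (a *: v) (- a *: v); rewrite scaleNr subrr p0 -scaleNr.
  by rewrite (pZ v (a := - a)) ?oppr_gt0//; lra.
by rewrite mul0r scale0r p0.
Qed.

(** In the one-vector step the admissible values are those between [sup (r - p
    (u - v))] and [inf (p (u + v) - r)], over the pairs [(u, r)] of the graph;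
    sublinearity of [p] says that this interval is nonempty. *)
Lemma hahn_banach v0 :
  exists L : {linear V -> R^o}, (forall v, L v <= p v) /\ L v0 = p v0.
Proof.
pose G0 := [set (a *: v0, a * p v0 : R^o) | a in [set: R]].
pose P := [set q : V * R^o | q.2 <= p q.1].
have [|q [a _ <-]||L [LP LG]] := @linear_extension _ V R^o G0 P.
- split; first by exists 0; rewrite // scale0r mul0r.
    move=> a _ _ [b _ <-] [c _ <-]; exists (a * b + c) => //.
    by rewrite scalerDl -scalerA mulrDl -mulrA.
  move=> y [a _ [/eqP]]; rewrite scaler_eq0 => /orP[/eqP-> <-|/eqP-> <-].
    by rewrite mul0r.
  by rewrite p0 mulr0.
- exact: sublinear_scale_ge.
- move=> G [G00 Gl Gu] GP v.
  pose S := [set q.2 - p (q.1 - v) | q in G].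
  have Sub q : G q -> ubound S (p (q.1 + v) - q.2).
    move=> Gq _ [r Gr <-].
    have Grq : r.2 + q.2 <= p (r.1 + q.1).
      by have := GP _ (Gl 1 _ _ Gr Gq); rewrite scale1r.
    by have := pD (r.1 - v) (q.1 + v); rewrite addrACA addNr addr0; lra.
  have S0 : S !=set0 by exists (0 - p (0 - v)), (0, 0).
  have Slow q : G q -> q.2 - p (q.1 - v) <= sup S.
    move=> Gq; apply: ub_le_sup; last by exists q.
    by exists (p (0 + v) - 0); exact: Sub G00.
  have Sup q : G q -> sup S <= p (q.1 + v) - q.2.
    by move=> Gq; apply: ge_sup => //; exact: Sub.
  exists (sup S) => a q Gq; rewrite /P/=.
  have Gaq b : G (b *: q) by have := Gl b _ _ Gq G00; rewrite addr0.
  have [a0|a0|<-] := ltgtP 0 a; last 2 first.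
  + have := Slow _ (Gaq (- a^-1)); have na0 : 0 < - a by rewrite oppr_gt0.
    rewrite -(ler_pM2l na0) mulrBr -pZ// scalerBr /= !scalerA.
    rewrite mulrNN divff ?lt_eqF// scale1r.
    rewrite [(- a^-1) *: q.2]/(_ * _) mulrA mulrNN divff ?lt_eqF// mul1r.
    rewrite scaleNr opprK [a *: v + _]addrC -[a *: sup S]/(a * _); lra.
  + by rewrite !scale0r !add0r; exact: GP.
  have := Sup _ (Gaq a^-1); rewrite -(ler_pM2l a0) mulrBr -pZ// scalerDr /=.
  rewrite [a^-1 *: q.2]/(_ * _) mulrA divff ?gt_eqF// mul1r.
  rewrite scalerA divff ?gt_eqF// scale1r [a *: v + _]addrC.
  rewrite -[a *: sup S]/(a * _); lra.
exists L; split => //; apply: LG; exists 1 => //.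
by rewrite scale1r mul1r.
Qed.

End hahn_banach.

(** * Real-valued norms *)

Section real_norm_theory.
Context {R : realType} {s : scalars}.
Local Notation K := (scalar_field R s).

Lemma of_real1 : of_real s 1 = 1 :> K.
Proof. by case: s. Qed.

Lemma of_realN a : of_real s (- a) = - of_real s a :> K.
Proof. by apply/eqP; rewrite -addr_eq0 -of_realD addNr of_real0. Qed.

Context {V : normedModType K}.
Implicit Types (x y : V).

Lemma of_real_norm x : of_real s (real_norm x) = `|x|.
Proof. exact: real_partK. Qed.

Lemma real_norm_ge0 x : 0 <= real_norm x.
Proof. exact: real_part_ge0. Qed.

Lemma real_normD x y : real_norm (x + y) <= real_norm x + real_norm y.
Proof. by rewrite -real_partD; apply: le_real_part; exact: ler_normD. Qed.

Lemma real_normZ (a : K^o) x : real_norm (a *: x) = real_norm a * real_norm x.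
Proof.
rewrite /real_norm normrZ -{1}(real_partK (normr_ge0 a)).
by rewrite -{1}(real_partK (normr_ge0 x)) -of_realM of_realK.
Qed.

Lemma real_normN x : real_norm (- x) = real_norm x.
Proof. by rewrite /real_norm normrN. Qed.

Lemma real_normC x y : real_norm (x - y) = real_norm (y - x).
Proof. by rewrite -real_normN opprB. Qed.

Lemma real_normB x y : real_norm (x - y) <= real_norm x + real_norm y.
Proof. by rewrite -[real_norm y]real_normN; exact: real_normD. Qed.

Lemma real_norm0 : real_norm (0 : V) = 0.
Proof. by rewrite /real_norm normr0 -(of_real0 (s := s)) of_realK. Qed.

Lemma real_norm0_eq0 x : real_norm x = 0 -> x = 0.
Proof.
by move=> x0; apply/normr0_eq0; rewrite -of_real_norm x0 of_real0.
Qed.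

Lemma real_norm_gt0 x : x <> 0 -> 0 < real_norm x.
Proof.
move=> x0; rewrite lt_neqAle real_norm_ge0 andbT eq_sym.
by apply/eqP => /real_norm0_eq0.
Qed.

Lemma real_norm_le0 x : (forall e, 0 < e -> real_norm x <= e) -> x = 0.
Proof.
move=> xe; apply: real_norm0_eq0; apply/eqP; rewrite eq_le real_norm_ge0 andbT.
by apply/ler_addgt0Pl => e e0; rewrite addr0 xe.
Qed.

End real_norm_theory.

Section real_norm_scalars.
Context {R : realType} {s : scalars}.
Local Notation K := (scalar_field R s).

Lemma real_norm_of_real (a : R) : real_norm (of_real s a : K^o) = `|a|.
Proof.
have pos b : 0 <= b -> real_norm (of_real s b : K^o) = `|b|.
  move=> b0; rewrite [`|b|]ger0_norm// /real_norm ger0_norm ?of_realK//.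
  by rewrite -(of_real0 (s := s)) ler_of_real.
have [/pos//|a0] := leP 0 a.
rewrite -[a]opprK of_realN normrN.
by rewrite [LHS](@real_normN R s K^o) pos// oppr_ge0 ltW.
Qed.

Lemma real_norm_of_realZ (V : normedModType K) (a : R) (x : V) :
  real_norm (of_real s a *: x) = `|a| * real_norm x.
Proof. by rewrite real_normZ real_norm_of_real. Qed.

End real_norm_scalars.

(** * Separation of points from subspaces *)

(** The alias carries the real module structure that a space over the scalar
    field inherits, which is what the real Hahn-Banach theorem is applied to. *)
Definition realified (R : realType) (s : scalars)
  (V : lmodType (scalar_field R s)) : Type := V.

Section realified_lmodule.
Variables (R : realType) (s : scalars) (V : lmodType (scalar_field R s)).

HB.instance Definition _ := GRing.Zmodule.copy (realified V) V.

Let scale (a : R) (x : realified V) : realified V := of_real s a *: (x : V).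

Let scaleA a b v : scale a (scale b v) = scale (a * b) v.
Proof. by rewrite /scale scalerA of_realM. Qed.

Let scale1 : left_id 1 scale.
Proof. by move=> v; rewrite /scale of_real1 scale1r. Qed.

Let scaleDr : right_distributive scale +%R.
Proof. by move=> a u v; rewrite /scale scalerDr. Qed.

Let scaleDl v : {morph scale^~ v : a b / a + b}.
Proof. by move=> a b; rewrite /scale of_realD scalerDl. Qed.

HB.instance Definition _ :=
  GRing.Zmodule_isLmodule.Build R (realified V) scaleA scale1 scaleDr scaleDl.

End realified_lmodule.

Lemma real_norm_complex (R : realType) (a b : R) :
  @real_norm R ComplexScalars (R[i])^o (Complex a b) <= `|a| + `|b|.
Proof.
rewrite /real_norm /= -[leRHS]ger0_norm ?addr_ge0// -sqrtr_sqr ler_wsqrtr//.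
rewrite sqrrD !real_normK ?num_real// lerD2r lerDl.
by rewrite mulrn_wge0// mulr_ge0.
Qed.

(** Over the complex numbers [g] is half of [x |-> u x - i * u (i * x)]; the
    factor one half pays for estimating the modulus of a complex number by the
    sum of the moduli of its parts. *)
Lemma complexify (R : realType) (s : scalars)
    (X : normedModType (scalar_field R s)) (u : {linear realified X -> R^o}) :
    (forall x, `|u x| <= real_norm (x : X)) ->
  exists g : {linear X -> (scalar_field R s)^o},
    [/\ forall x, real_norm (g x) <= real_norm x,
        forall x, (forall a, u (a *: x : X) = 0) -> g x = 0 &
        forall x, g x = 0 -> u x = 0].
Proof.
have uD (x y : X) : u (x + y) = u x + u y by exact: (linearD u).
have uZ (a : R) (x : X) : u (of_real s a *: x : X) = a * u x.
  by rewrite -[LHS]/(u (a *: (x : realified X))) linearZ.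
move=> ule; have ule1 (a : (scalar_field R s)^o) (x : X) : real_norm a <= 1 ->
    `|u (a *: x : X)| <= real_norm x.
  move=> a1; apply: (le_trans (ule _)); rewrite real_normZ -[leRHS]mul1r.
  by rewrite ler_wpM2r// real_norm_ge0.
case: s X u uD uZ ule ule1 => /= X u uD uZ ule ule1.
  have glin : linear (u : X -> R^o) by move=> a x y; rewrite uD uZ.
  have [g gE] := bundle_linear glin.
  exists g; split=> [x|x /(_ 1)|x]; rewrite gE//.
  by rewrite scale1r.
pose I : R[i] := Complex 0 1.
pose gf (x : X) : R[i]^o := Complex (u x / 2) (- (u (I *: x)) / 2).
have decomp (a b : R) (x : X) :
    (Complex a b : R[i]) *: x = (of_real ComplexScalars a : R[i]) *: x
       + (of_real ComplexScalars b : R[i]) *: (I *: x).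
  rewrite scalerA -scalerDl; congr (_ *: _); apply/eqP.
  by rewrite eq_complex /= !mulr0 !mul0r mulr1 subr0 !(addr0, add0r) !eqxx.
have II (x : X) : I *: (I *: x) = (of_real ComplexScalars (-1) : R[i]) *: x.
  rewrite scalerA; congr (_ *: _); apply/eqP.
  by rewrite eq_complex /= !mulr0 !mul0r mulr1 sub0r addr0 !eqxx.
have glin : linear gf.
  case=> a b x y; apply/eqP; rewrite eq_complex /gf /=.
  rewrite !scalerDr [I *: (_ *: _)]scalerA [I * _]mulrC -scalerA.
  rewrite (decomp a b x) (decomp a b (I *: x)) !II.
  rewrite !uD !uZ; apply/andP; by split; apply/eqP; field.
have [g gE] := bundle_linear glin.
exists g; split=> [x|x ux0|x]; rewrite gE; last 2 first.
- have := ux0 1; rewrite scale1r /= /gf => ->; rewrite ux0.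
  by rewrite oppr0 mul0r.
- by move=> [/eqP + _]; rewrite mulf_eq0 invr_eq0 pnatr_eq0 orbF => /eqP.
have uI : `|u (I *: x)| <= complex.Re `|x|.
  apply: ule1; apply: (le_trans (real_norm_complex 0 1)).
  by rewrite normr0 normr1 add0r.
apply: (le_trans (real_norm_complex (u x / 2) (- u (I *: x) / 2))).
rewrite !normrM normrN [`|2^-1|]ger0_norm ?invr_ge0//.
have := ule x; lra.
Qed.

(** Hahn-Banach for the seminorm given by the distance to [V]. *)
Lemma separate_from_subspace (R : realType) (s : scalars)
    (X : normedModType (scalar_field R s)) (V : set X) (x : X) (d : R) :
    V 0 -> (forall a u v, V u -> V v -> V (a *: u + v)) ->
    0 < d -> (forall v, V v -> d <= real_norm (x - v)) ->
  exists g : {linear X -> (scalar_field R s)^o},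
    [/\ forall y, real_norm (g y) <= real_norm y,
        forall v, V v -> g v = 0 & g x <> 0].
Proof.
move=> V0 Vlin d0 xV.
pose D y := [set real_norm (y - v) | v in V].
pose p (y : realified X) : R := inf (D y).
have D0 y : D y !=set0 by exists (real_norm (y - 0)), 0.
have Dlb y : has_lbound (D y).
  by exists 0 => _ [v _ <-]; exact: real_norm_ge0.
have ple y v : V v -> p y <= real_norm (y - v).
  by move=> Vv; apply: ge_inf => //; exists v.
have gep (y : X) c : (forall v, V v -> c <= real_norm (y - v)) -> c <= p y.
  by move=> cy; apply: lb_le_inf => // _ [v Vv <-]; exact: cy.
have pD u v : p (u + v) <= p u + p v.
  rewrite -lerBlDr; apply: (gep) => w Vw; rewrite lerBlDr -lerBlDl.
  apply: (gep v) => w' Vw'; rewrite lerBlDl.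
  have Vww' : V (w + w') by have := Vlin 1 _ _ Vw Vw'; rewrite scale1r.
  apply: (le_trans (ple _ _ Vww')); apply: le_trans (real_normD _ _).
  by rewrite opprD addrACA [(_ - w) + _]addrC.
have VZ a v : V v -> V (a *: v).
  by move=> Vv; have := Vlin a _ _ Vv V0; rewrite addr0.
have pZle a v : 0 < a -> p (a *: v) <= a * p v.
  move=> a0; rewrite -ler_pdivrMl//; apply: gep => w Vw.
  rewrite ler_pdivrMl//; apply: (le_trans (ple _ _ (VZ (of_real s a) _ Vw))).
  by rewrite -scalerBr real_norm_of_realZ gtr0_norm.
have pZ a v : 0 < a -> p (a *: v) = a * p v.
  move=> a0; apply/eqP; rewrite eq_le pZle//=.
  rewrite -ler_pdivlMl//; have := pZle a^-1 (a *: v).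
  by rewrite scalerA mulVf ?gt_eqF// scale1r; apply; rewrite invr_gt0.
have [u [up ux]] := hahn_banach pD pZ x.
have pn y : p y <= real_norm (y : X).
  by have := ple y _ V0; rewrite subr0.
have ule y : `|u y| <= real_norm (y : X).
  rewrite ler_norml (le_trans (up y))// andbT lerNl -linearN.
  by apply: (le_trans (up _)); apply: (le_trans (pn _)); rewrite real_normN.
have uV y : V y -> u y = 0.
  move=> Vy; have up0 z : V z -> u z <= 0.
    move=> Vz; apply: (le_trans (up _)); have := ple z z Vz.
    by rewrite subrr real_norm0.
  apply/eqP; rewrite eq_le up0//= -oppr_le0 -linearN up0//.
  by have := VZ (-1) _ Vy; rewrite scaleN1r.
have [g [gle gV gu]] := complexify ule.
exists g; split => // [v Vv|/gu]; first by apply: gV => a; exact/uV/VZ.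
by rewrite ux => px0; have := gep x d xV; rewrite px0 leNgt d0.
Qed.

(** * Linear spans and null sequences *)

Section span_lemmas.
Context {R : realType} {s : scalars}.
Local Notation K := (scalar_field R s).
Context {X : normedModType K}.
Implicit Types A : set X.

Lemma linear_span_ind A (P : set X) : P 0 ->
  (forall (a : K) u v, A u -> P v -> P (a *: u + v)) -> linear_span A `<=` P.
Proof.
move=> P0 Pl _ [n [a [x [Ax ->]]]].
elim: n a x Ax => [|n IHn] a x Ax; first by rewrite big_ord0.
by rewrite big_ord_recl; apply: Pl => //; apply: IHn.
Qed.

Lemma linear_span0 A : linear_span A 0.
Proof.
by exists 0%N, (fun _ => 0), (fun _ => 0); split; [case|rewrite big_ord0].
Qed.

Lemma linear_span_cons A (a : K) u v :
  A u -> linear_span A v -> linear_span A (a *: u + v).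
Proof.
move=> Au [n [b [x [Ax ->]]]].
exists n.+1, (fun i => oapp b a (unlift ord0 i)),
  (fun i => oapp x u (unlift ord0 i)); split.
  by move=> i; case: unliftP => [j _|_] /=.
rewrite big_ord_recl unlift_none /=; congr (_ + _).
by apply: eq_bigr => i _; rewrite liftK.
Qed.

Lemma linear_span_lin A (a : K) u v :
  linear_span A u -> linear_span A v -> linear_span A (a *: u + v).
Proof.
move=> Au Av; move: u Au.
apply: linear_span_ind => [|b u w Au Aw]; first by rewrite scaler0 add0r.
by rewrite scalerDr scalerA -addrA; exact: linear_span_cons.
Qed.

Lemma sub_linear_span A : A `<=` linear_span A.
Proof.
move=> x Ax; rewrite -[x]addr0 -[x]scale1r.
exact/linear_span_cons/linear_span0.
Qed.

Lemma dense_approx A : dense A <->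
  forall (x : X) (e : R), 0 < e -> exists2 v, A v & real_norm (x - v) < e.
Proof.
split=> [Ad x e e0|Ad O [x Ox] Oo].
  have e0' : 0 < of_real s e :> K by rewrite -(of_real0 (s := s)) ltr_of_real.
  have [|v [/interior_subset xv Av]] :=
      Ad (ball x (of_real s e))^° _ (open_interior _).
    by exists x; exact: nbhsx_ballx.
  exists v => //.
  by move: xv; rewrite -ball_normE /= -of_real_norm ltr_of_real.
have /nbhs_ballP[e /= e0 eO] : nbhs x O by exact: open_nbhs_nbhs.
have [|v Av xv] := Ad x (real_part e).
  by rewrite -(@ltr_of_real R s) of_real0 real_partK// ltW.
exists v; split => //; apply: eO; rewrite -ball_normE /= -of_real_norm.
by rewrite -[e](@real_partK R s) ?ltr_of_real// ltW.
Qed.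

End span_lemmas.

Section null_sequence_lemmas.
Context {R : realType} {s : scalars}.
Local Notation K := (scalar_field R s).

Lemma null_seqE (u : nat -> K) : u \in @null_seq R s <->
  forall e : R, 0 < e -> exists N, forall n, (N <= n)%N ->
    real_norm (u n : K^o) <= e.
Proof.
split=> [/null_seqP/cvgrPdist_le u0 e e0|u0].
  have [|N _ uN] := u0 (of_real s e).
    by rewrite -(of_real0 (s := s)) ltr_of_real.
  exists N => n /uN /=; rewrite sub0r normrN -(@ler_of_real R s).
  by rewrite of_real_norm.
apply/null_seqP/cvgrPdist_le => e e0.
have [|N uN] := u0 (real_part e).
  by rewrite -(@ltr_of_real R s) of_real0 real_partK// ltW.
exists N => // n /uN /=; rewrite sub0r normrN -(@ler_of_real R s).
by rewrite of_real_norm real_partK// ltW.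
Qed.

Lemma null_seq_close (u : nat -> K) :
  (forall e : R, 0 < e -> exists2 v, v \in @null_seq R s &
    forall n, real_norm (u n - v n : K^o) <= e) -> u \in @null_seq R s.
Proof.
move=> uv; apply/null_seqE => e e0.
have e20 : 0 < e / 2 by rewrite divr_gt0.
have [v /null_seqE/(_ _ e20)[N vN] uve] := uv _ e20.
exists N => n /vN vn; have := real_normD (u n - v n : K^o) (v n).
by rewrite subrK; have := uve n; lra.
Qed.

End null_sequence_lemmas.

(** * Sequences of functionals on a weakly compact set *)

Definition norm_bounded (R : realType) (s : scalars)
  (X Y : normedModType (scalar_field R s)) (c : R) (g : X -> Y) :=
  forall x, real_norm (g x) <= c * real_norm x.

Section weakly_compact_sets.
Context {R : realType} {s : scalars}.
Local Notation K := (scalar_field R s).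
Context {X : normedModType K}.
Implicit Types (W D : set X) (f h : nat -> {linear X -> K^o}).

Lemma norm_bounded_continuous c (g : {linear X -> K^o}) :
  norm_bounded c g -> continuous g.
Proof.
move=> gc; apply/linear_bounded_continuous/linear_boundedP.
exists (of_real s c); split.
  have [c0|/ltW c0] := leP 0 c.
    by apply: ger0_real; rewrite -(of_real0 (s := s)) ler_of_real.
  by apply: ler0_real; rewrite -(of_real0 (s := s)) ler_of_real.
move=> r cr x; apply: (@le_trans _ _ (of_real s c * `|x|)).
  by rewrite -!of_real_norm -of_realM ler_of_real.
by rewrite ler_wpM2r// ltW.
Qed.

Lemma weakly_compact_cluster W (d : nat -> X) :
  weakly_compact W -> (forall n, W (d n)) ->
  exists2 w, W w & forall c (g : {linear X -> K^o}), norm_bounded c g ->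
    forall (e : R) N, 0 < e ->
      exists2 n, (N <= n)%N & real_norm (g (d n) - g w) < e.
Proof.
move=> Wc Wd; have [|w [Ww wd]] := Wc (d @ \oo) _.
  by exists 0%N => // n _; exact: Wd.
exists w => // c g /norm_bounded_continuous gc e N e0.
have wB : nbhs (w : weak_topology X) [set x | real_norm (g x - g w) < e].
  have wg : nbhs (w : weak_topology X) `=>`
      nbhs (w : initial_topology (g : X -> K^o)).
    have FF : Filter (nbhs (w : weak_topology X)) by exact: nbhs_filter.
    by have /(_ (exist _ g gc)) := (@cvg_sup _ _ _ _ w FF).1 (@cvg_refl _ _).
  apply: wg.
  apply: (@initial_continuous _ _ (g : X -> K^o) w
    [set y | real_norm (y - g w) < e]).
  apply/nbhs_ballP; exists (of_real s e) => /=.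
    by rewrite -(of_real0 (s := s)) ltr_of_real.
  move=> y; rewrite -ball_normE /= -of_real_norm ltr_of_real.
  by rewrite real_normC.
have [|x [[n [Nn <-]]]] := wd (d @` [set n | (N <= n)%N]) _ _ wB.
  by exists N => // n Nn; exists n.
by move=> wn; exists n.
Qed.

(** [D] is dense in [W] for the topology of pointwise convergence on the
    functionals [f i]. *)
Definition approximates D W f := forall k w (e : R), W w -> 0 < e ->
  exists2 d, D d & forall i, (i < k)%N -> real_norm (f i d - f i w) <= e.

(** Choose [d k] in [D] that is close to [w] on the first [k] functionals; a
    weak cluster point [w'] of this sequence has the same values as [w] under
    every [f i], and it lies in the closed span of [D] because closed
    subspaces are weakly closed. *)
Lemma weakly_compact_representative W D f :
  weakly_compact W -> D `<=` W -> (forall i, exists c, norm_bounded c (f i)) ->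
  approximates D W f -> forall w, W w ->
  exists2 w', forall i, f i w' = f i w & forall e : R, 0 < e ->
    exists2 v, linear_span D v & real_norm (w' - v) < e.
Proof.
move=> Wc DW fb Df w Ww.
have Dk k : exists d, D d /\
    forall i, (i < k)%N -> real_norm (f i d - f i w) <= k.+1%:R^-1.
  have [|d Dd dk] := Df k w k.+1%:R^-1 Ww; first by rewrite invr_gt0.
  by exists d.
have [d dP] := choice Dk.
have [|w' Ww' w'd] := weakly_compact_cluster (d := d) Wc.
  by move=> n; apply: DW; case: (dP n).
exists w' => [i|e e0].
  apply/eqP; rewrite -subr_eq0; apply/eqP/real_norm_le0 => e e0.
  have e20 : 0 < e / 2 by rewrite divr_gt0.
  have [c fic] := fb i.
  have [N Ne] : exists N, N.+1%:R^-1 <= e / 2.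
    exists (Num.truncn (e / 2)^-1); rewrite -[leRHS]invrK lef_pV2 ?posrE//.
      by rewrite ltW// truncnS_gt.
    by rewrite invr_gt0.
  have [n Nn dn] := w'd c (f i) fic (e / 2) (maxn N i.+1) e20.
  move: Nn; rewrite geq_max => /andP[Nn iN].
  have [_ /(_ _ iN) fin] := dP n.
  have nN : n.+1%:R^-1 <= N.+1%:R^-1 :> R.
    by rewrite lef_pV2 ?posrE// ler_nat ltnS.
  have -> : f i w' - f i w = (f i (d n) - f i w) - (f i (d n) - f i w').
    by rewrite opprB [RHS]addrC subrKA.
  rewrite [e]splitr; apply: (le_trans (real_normB _ _)); apply: lerD.
    exact: (le_trans fin (le_trans nN Ne)).
  exact: ltW.
apply: contrapT => w'D.
have [|v Dv|g [g1 gD gw']] :=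
    @separate_from_subspace R s X (linear_span D) w' e (linear_span0 D) _ e0.
- by move=> a u v; exact: linear_span_lin.
- by rewrite leNgt; apply/negP => vw; apply: w'D; exists v.
have gb : norm_bounded 1 g by move=> x; rewrite mul1r.
have [n _] := w'd 1 g gb _ 0%N (real_norm_gt0 gw').
by rewrite gD ?sub0r ?real_normN ?ltxx//; apply: sub_linear_span; case: (dP n).
Qed.

Lemma null_closed (h : nat -> {linear X -> K^o}) c A :
  (forall i, norm_bounded c (h i)) ->
  (forall d, A d -> h^~ d \in @null_seq R s) -> forall x,
  (forall e : R, 0 < e -> exists2 v, linear_span A v & real_norm (x - v) < e) ->
  h^~ x \in @null_seq R s.
Proof.
move=> hc hA x xA; apply: null_seq_close => e e0.
have c0 : 0 < Num.max c 1 by rewrite lt_max ltr01 orbT.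
have [|v Av xv] := xA (e / Num.max c 1); first by rewrite divr_gt0.
exists (h^~ v).
  move: v Av {xv}; apply: linear_span_ind => [|a u v Au hv].
    suff -> : h^~ 0 = 0 :> (nat -> K) by exact: rpred0.
    by apply/funext => n; rewrite linear0.
  have -> : h^~ (a *: u + v) = a *: (h^~ u) + h^~ v :> (nat -> K).
    by apply/funext => n; rewrite linearP.
  by rewrite rpredD// rpredZ// hA.
move=> n; rewrite -linearB; apply: (le_trans (hc n _)).
apply: (@le_trans _ _ (Num.max c 1 * real_norm (x - v))).
  by rewrite ler_wpM2r ?real_norm_ge0// le_max lexx.
by rewrite -ler_pdivlMl// mulrC ltW.
Qed.

(** The principle behind both halves of the theorem: convergence to zero of a
    bounded sequence of functionals needs to be checked only on a subset [D]
    of [W] which is dense for the pointwise topology of the [f i], as soon as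
    the [h i] vanish where all the [f i] do. For then a point of [W] may be
    replaced by its representative in the closed span of [D]. As [D] can be
    chosen countable, sequences of functionals see a weakly compactly
    generated space as if it were separable. *)
Lemma null_on_generated W D f h c :
  weakly_compact W -> dense (linear_span W) -> D `<=` W ->
  (forall i, exists c, norm_bounded c (f i)) -> approximates D W f ->
  (forall i, norm_bounded c (h i)) ->
  (forall x, (forall i, f i x = 0) -> forall i, h i x = 0) ->
  (forall d, D d -> h^~ d \in @null_seq R s) ->
  forall x, h^~ x \in @null_seq R s.
Proof.
move=> Wc /dense_approx Wd DW fb Df hc fh hD x.
apply: (null_closed (A := W) hc) => [w Ww|e e0]; last exact: Wd.
have [w' fw w'D] := weakly_compact_representative Wc DW fb Df Ww.
have -> : h^~ w = h^~ w'.
  apply/funext => i; apply/eqP; rewrite -subr_eq0 -linearB; apply/eqP/fh => j.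
  by rewrite linearB fw subrr.
exact: (null_closed hc hD).
Qed.

End weakly_compact_sets.

(** * Countable nets and annihilators *)

Lemma countable_range (I : countType) (T : Type) (f : I -> T) :
  countable (range f).
Proof. exact: card_le_trans (card_image_le f setT) (countableP _). Qed.

Lemma countable_subset (T : Type) (A B : set T) :
  A `<=` B -> countable B -> countable A.
Proof. by move=> AB; exact/sub_countable/subset_card_le. Qed.

Lemma countable_sub_range (T : Type) (x0 : T) (D : set T) :
  countable D -> exists u : nat -> T, D `<=` range u.
Proof.
move=> /countable_injP[f finj].
have uP n : exists x, (exists2 y, D y & f y = n) -> D x /\ f x = n.
  have [[y Dy fy]|nD] := pselect (exists2 y, D y & f y = n); first by exists y.
  by exists x0 => /nD.
have [u {}uP] := choice uP.
exists u => x Dx; exists (f x) => //.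
have [|Du fu] := uP (f x); first by exists x.
by apply: finj => //; rewrite inE.
Qed.

Lemma countable_lists (T : Type) (C : set T) : countable C ->
  countable [set l : seq T | forall x, List.In x l -> C x].
Proof.
have [[x0 Cx0]|C0] := pselect (C !=set0).
  move=> /(countable_sub_range x0)[u Cu].
  apply: (@countable_subset _ _ (range (map u))).
    move=> l; elim: l => [|x l IHl] Cl.
      by exists [::].
    have [|n _ xE] := Cu x; first by apply: Cl; left.
    have [|m _ lE] := IHl; first by move=> y yl; apply: Cl; right.
    by exists (n :: m) => //=; rewrite xE lE.
  exact: countable_range.
move=> _; apply: (@countable_subset _ _ [set [::]]); last exact: countable1.
move=> [//|x l Cl]; exfalso; apply: C0.
by exists x; apply: Cl; left.
Qed.

Section countable_nets.
Context {R : realType} {s : scalars}.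
Local Notation K := (scalar_field R s).
Context {X : normedModType K}.
Implicit Types (W D : set X).

Definition rational_scalar (q : rat * rat) : K :=
  match s return scalar_field R s with
  | RealScalars => ratr q.1
  | ComplexScalars => Complex (ratr q.1) (ratr q.2)
  end.

Lemma rational_scalar_dense (z : K^o) (e : R) : 0 < e ->
  exists q, real_norm (z - rational_scalar q : K^o) < e.
Proof.
have ratP (x d : R) : 0 < d -> exists q : rat, `|x - ratr q| < d.
  move=> d0; have [|q] := @rat_in_itvoo R (x - d) (x + d).
    by rewrite ltrBlDr -addrA ltrDl addr_gt0.
  rewrite in_itv /= => /andP[xq qx]; exists q.
  by rewrite ltr_norml; lra.
rewrite /rational_scalar; case: s z => /= z e0.
  by have [q qz] := ratP z e e0; exists (q, 0).
case: z => a b; have e20 : 0 < e / 2 by rewrite divr_gt0.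
have [q qa] := ratP a _ e20; have [r rb] := ratP b _ e20.
exists (q, r).
apply: (le_lt_trans (real_norm_complex (a - ratr q) (b - ratr r))).
by lra.
Qed.

Let zero_functional : {linear X -> K^o} := \0.
Local Notation "l `[ i ]" := (nth zero_functional l i) (at level 1).

(** The values of [l] on [W] form a subset of a finite power of the scalar
    field; for each rational point and each precision, [D] contains one point
    of [W] whose values are that close to the rational point, if there is one. *)
Lemma countable_net_nth W (l : seq {linear X -> K^o}) :
  exists D, [/\ countable D, D `<=` W & forall w (e : R), W w -> 0 < e ->
    exists2 d, D d & forall i, (i < size l)%N ->
      real_norm (l`[i] d - l`[i] w) <= e].
Proof.
pose S (c : seq (rat * rat) * nat) := [set w | W w /\
  forall i, (i < size l)%N ->
    real_norm (l`[i] w - rational_scalar (nth 0 c.1 i) : K^o) <= c.2.+1%:R^-1].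
pose D := W `&` range (fun c => xget 0 (S c)).
exists D; split; last 2 first.
- exact: subIsetl.
- move=> w e Ww e0.
  have [n ne] : exists n, n.+1%:R^-1 <= e / 2.
    exists (Num.truncn (e / 2)^-1); rewrite -[leRHS]invrK lef_pV2 ?posrE//.
      by rewrite ltW// truncnS_gt.
    by rewrite invr_gt0 divr_gt0.
  have qP (i : nat) : exists q, real_norm (l`[i] w - rational_scalar q : K^o)
      < n.+1%:R^-1 by apply: rational_scalar_dense; rewrite invr_gt0.
  have [q {}qP] := choice qP.
  pose c := (mkseq q (size l), n).
  have Sw : S c w.
    by split=> // i il; rewrite nth_mkseq// ltW.
  have [Wd dP] := xgetI 0 Sw.
  exists (xget 0 (S c)); first by split => //; exists c.
  move=> i il; have := dP i il; have := qP i; rewrite nth_mkseq//.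
  set a : K^o := rational_scalar _; set d := xget _ _ => wa da.
  have -> : l`[i] d - l`[i] w = (l`[i] d - a) - (l`[i] w - a) :> K^o.
    by rewrite opprB addrA subrK.
  apply: (le_trans (real_normB _ _)); rewrite [e]splitr; apply: lerD.
    exact: le_trans da ne.
  exact: le_trans (ltW wa) ne.
apply: (@countable_subset _ _ (range (fun c => xget 0 (S c)))).
  exact: subIsetr.
exact: countable_range.
Qed.

Lemma countable_net W (l : seq {linear X -> K^o}) :
  exists D, [/\ countable D, D `<=` W & forall w (e : R), W w -> 0 < e ->
    exists2 d, D d & forall g, List.In g l -> real_norm (g d - g w) <= e].
Proof.
have [D [Dc DW DP]] := countable_net_nth W l; exists D; split => // w e Ww e0.
have [d Dd dP] := DP w e Ww e0; exists d => // g gl.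
suff [i il <-] : exists2 i, (i < size l)%N & l`[i] = g by exact: dP.
elim: l gl {Dd dP DP} => //= h l IHl [->|/IHl[i il ig]]; first by exists 0%N.
by exists i.+1.
Qed.

Lemma countable_approximates W (f : nat -> {linear X -> K^o}) :
  exists D, [/\ countable D, D `<=` W & approximates D W f].
Proof.
have [D DP] := choice (fun k => countable_net_nth W (mkseq f k)).
exists (\bigcup_k D k); split.
- by apply: bigcup_countable => // k _; case: (DP k).
- by move=> x [k _]; have [_ + _] := DP k; apply.
move=> k w e Ww e0; have [_ _ /(_ w e Ww e0)[d Dd dk]] := DP k.
exists d => [|i ik]; first by exists k.
by have := dk i; rewrite size_mkseq nth_mkseq//; apply.
Qed.

(** The closed span of a countable set is separable, hence proper. *)
Lemma nonseparable_annihilator D : ~ separable_space X -> countable D ->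
  exists g : {linear X -> K^o},
    [/\ norm_bounded 1 g, forall d, D d -> g d = 0 & exists x, g x <> 0].
Proof.
move=> Xns Dc.
suff [x [e e0 xe]] : exists x, exists2 e : R, 0 < e &
    forall v, linear_span D v -> e <= real_norm (x - v).
  have [|g [g1 gD gx]] :=
      separate_from_subspace (linear_span0 D) _ e0 xe.
    by move=> a u v; exact: linear_span_lin.
  exists g; split; last by exists x.
    by move=> y; rewrite mul1r.
  by move=> d /sub_linear_span; exact: gD.
apply: contrapT => nD; apply: Xns.
have [u Du] := countable_sub_range (0 : X) Dc.
pose comb (c : seq ((rat * rat) * nat)) : X :=
  \sum_(p <- c) rational_scalar p.1 *: u p.2.
have combD : forall v, linear_span D v -> forall e : R, 0 < e ->
    exists c, real_norm (v - comb c) < e.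
  apply: linear_span_ind => [e e0|a v w Dv wP e e0].
    by exists [::]; rewrite /comb big_nil subrr real_norm0.
  have e20 : 0 < e / 2 by rewrite divr_gt0.
  have [c wc] := wP _ e20; have [n _ un] := Du _ Dv.
  have v0 : 0 < real_norm v + 1 by rewrite ltr_wpDl// real_norm_ge0.
  have [|q aq] := @rational_scalar_dense a (e / 2 / (real_norm v + 1)).
    by rewrite divr_gt0.
  exists ((q, n) :: c); rewrite /comb big_cons /= un -/(comb c).
  rewrite opprD addrACA -scalerBl (le_lt_trans (real_normD _ _))//.
  rewrite [e]splitr ltr_leD ?ltW//.
  rewrite real_normZ; set z : K^o := a - _.
  apply: (@le_lt_trans _ _ (real_norm z * (real_norm v + 1))).
    by rewrite ler_wpM2l ?real_norm_ge0// lerDl.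
  by rewrite -ltr_pdivlMr.
exists (range comb); split.
  exact: countable_range.
apply/dense_approx => x e e0.
have e20 : 0 < e / 2 by rewrite divr_gt0.
have [v Dv xv] : exists2 v, linear_span D v & real_norm (x - v) < e / 2.
  apply: contrapT => xD; apply: nD; exists x, (e / 2) => // v Dv.
  by rewrite leNgt; apply/negP => xv; apply: xD; exists v.
have [c vc] := combD v Dv _ e20.
exists (comb c); first by exists c.
have -> : x - comb c = (x - v) + (v - comb c) by rewrite addrA subrK.
by rewrite (le_lt_trans (real_normD _ _))// [e]splitr ltrD.
Qed.

End countable_nets.

(** * Correcting a sequence of functionals to a weak-star null one *)

Section ultrafilter_limits.
Context {R : realType} (U : set_system nat) {UU : UltraFilter U}.

Lemma real_ultrafilter_limit (r : nat -> R) c : (forall n, `|r n| <= c) ->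
  exists l, forall e, 0 < e -> U [set n | `|r n - l| < e].
Proof.
move=> rc; have UF : ProperFilter U by exact: ultra_proper.
pose A := [set t | U [set n | t <= r n]].
have Aub : ubound A c.
  move=> t /filter_ex[n tn]; apply: le_trans tn _.
  by apply: le_trans (rc n); exact: ler_norm.
have A0 : A (- c).
  apply: filterS filterT => n _ /=; have := rc n; rewrite ler_norml.
  by case/andP.
exists (sup A) => e e0.
have As : has_sup A by split; [exists (- c)|exists c].
have [t At te] := sup_adherent e0 As.
have : ~ A (sup A + e / 2).
  move=> Ae; have := ub_le_sup As.2 Ae.
  by rewrite gerDl leNgt divr_gt0.
have [//|nA _] := in_ultra_setVsetC [set n | sup A + e / 2 <= r n] UU.
apply: filterS (filterI At nA) => n [/= tn /negP]; rewrite -ltNge => ne.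
by rewrite ltr_norml; apply/andP; split; lra.
Qed.

Lemma ultrafilter_limit (s : scalars) (u : nat -> (scalar_field R s)^o) c :
  (forall n, real_norm (u n) <= c) ->
  exists l, forall e, 0 < e -> U [set n | real_norm (u n - l) < e].
Proof.
have UF : ProperFilter U by exact: ultra_proper.
case: s u => u uc; first exact: (real_ultrafilter_limit uc).
have reim n : `|complex.Re (u n)| <= c /\ `|complex.Im (u n)| <= c.
  have := uc n; rewrite /real_norm; case: (u n) => a b /= abc.
  by split; apply: le_trans abc; rewrite -sqrtr_sqr ler_wsqrtr//
    ?lerDl ?lerDr sqr_ge0.
have [a ua] := real_ultrafilter_limit (fun n => (reim n).1).
have [b ub] := real_ultrafilter_limit (fun n => (reim n).2).
exists (Complex a b) => e e0; have e20 : 0 < e / 2 by rewrite divr_gt0.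
apply: filterS (filterI (ua _ e20) (ub _ e20)) => n [/= an bn].
have -> : u n - Complex a b =
    Complex (complex.Re (u n) - a) (complex.Im (u n) - b) :> R[i].
  by case: (u n).
by apply: (le_lt_trans (real_norm_complex _ _)); lra.
Qed.

End ultrafilter_limits.

Section correction.
Context {R : realType} {s : scalars}.
Local Notation K := (scalar_field R s).
Context {X : normedModType K}.
Variable L : nat -> {linear X -> K^o}.
Hypothesis Lbnd : forall x, exists c, forall n, real_norm (L n x) <= c.

(** Equivalently, [real_norm (g x)] is at most the upper limit of the sequence
    [real_norm (L n x)], for every [x]. *)
Definition limsup_dominated (g : {linear X -> K^o}) := forall x c N,
  (forall n, (N <= n)%N -> real_norm (L n x) <= c) -> real_norm (g x) <= c.

(** [g] is the pointwise limit of the [L n] along an ultrafilter that contains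
    [S] and the complements of the finite sets. *)
Lemma weak_star_cluster (S : set nat) :
    (forall N, exists2 n, (N <= n)%N & S n) ->
  exists2 g, limsup_dominated g & forall (x : nat -> X) k (e : R), 0 < e ->
    exists2 n, S n & forall j, (j < k)%N -> real_norm (L n (x j) - g (x j)) < e.
Proof.
move=> Sinf.
pose B N := S `&` [set n | (N <= n)%N].
have FF : ProperFilter (filter_from [set: nat] B).
  apply: filter_from_proper => [|N _]; last first.
    by have [n Nn Sn] := Sinf N; exists n.
  apply: filter_from_filter => [|N M _ _]; first by exists 0%N.
  exists (maxn N M) => // n [Sn /=]; rewrite geq_max => /andP[Nn Mn].
  by split.
have [U [UU FU]] := ultraFilterLemma FF.
have UF : ProperFilter U by exact: ultra_proper.
have UB N : U (B N) by apply: FU; exists N.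
have gP x : exists l : K^o, forall e, 0 < e ->
    U [set n | real_norm (L n x - l) < e].
  by have [c xc] := Lbnd x; exact: ultrafilter_limit xc.
have [g0 {}gP] := choice gP.
have glin : linear (g0 : X -> K^o).
  move=> a x y; apply/eqP; rewrite -subr_eq0; apply/eqP/real_norm_le0 => e e0.
  pose d := e / (real_norm (a : K^o) + 2).
  have a2 : 0 < real_norm (a : K^o) + 2 by rewrite ltr_wpDl// real_norm_ge0.
  have d0 : 0 < d by rewrite divr_gt0.
  have [n [[/= xn yn] axyn]] :=
    filter_ex (filterI (filterI (gP x d d0) (gP y d d0))
      (gP (a *: x + y) d d0)).
  rewrite linearP /= in axyn.
  have -> : g0 (a *: x + y) - (a *: g0 x + g0 y) =
      (a *: (L n x - g0 x) + (L n y - g0 y))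
      - (a *: L n x + L n y - g0 (a *: x + y)).
    by rewrite scalerBr [in RHS]addrACA -opprD opprB [RHS]addrC subrKA.
  apply: (le_trans (real_normB _ _)).
  have := real_normD (a *: (L n x - g0 x)) (L n y - g0 y).
  rewrite real_normZ => ineq.
  have eE : e = real_norm (a : K^o) * d + d + d.
    by rewrite -addrA -mulr2n -[d *+ 2]mulr_natl -mulrDl mulrC divfK ?gt_eqF.
  have ad : real_norm (a : K^o) * real_norm (L n x - g0 x) <=
      real_norm (a : K^o) * d.
    by rewrite ler_wpM2l ?real_norm_ge0 ?ltW.
  rewrite eE; apply: lerD; last exact: ltW.
  by apply: (le_trans ineq); apply: lerD => //; exact: ltW.
have [g gE] := bundle_linear glin.
exists g => [x c N xc|x k e e0].
  rewrite gE; apply/ler_addgt0Pr => e e0.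
  have [n [[_ Nn] /= xn]] := filter_ex (filterI (UB N) (gP x e e0)).
  have := real_normB (L n x) (L n x - g0 x).
  rewrite opprB addrC subrK => /le_trans.
  by apply; apply: lerD; [exact: xc|exact: ltW].
suff : U [set n | forall j, (j < k)%N -> real_norm (L n (x j) - g (x j)) < e].
  by move=> /(filterI (UB 0%N))/filter_ex[n [[Sn _] nP]]; exists n.
elim: k => [|k IHk]; first by apply: filterS filterT => n _.
apply: filterS (filterI IHk (gP (x k) e e0)) => n [/= IHn kn] j.
by rewrite ltnS leq_eqVlt => /predU1P[->|/IHn//]; rewrite gE.
Qed.

(** Veech's argument for Sobczyk's theorem. For every [k], all but finitely
    many [L n] are within [1 / (k + 1)], at the first [k] points, of some
    dominated functional: otherwise the exceptional indices would have a
    weak-star cluster point, which is dominated. It remains to let the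
    precision grow with [n]. *)
Lemma null_correction (x : nat -> X) :
  exists2 M : nat -> {linear X -> K^o}, forall n, limsup_dominated (M n) &
    forall j, (fun n => L n (x j) - M n (x j)) \in @null_seq R s.
Proof.
pose close n k g := forall j, (j < k)%N ->
  real_norm (L n (x j) - g (x j)) <= k.+1%:R^-1.
pose ok n k := exists2 g, limsup_dominated g & close n k g.
have okev k : exists N, forall n, (N <= n)%N -> ok n k.
  apply: contrapT => nok.
  have [|g gL] := weak_star_cluster (S := [set n | ~ ok n k]).
    move=> N; apply: contrapT => nN; apply: nok; exists N => n Nn.
    by apply: contrapT => okn; apply: nN; exists n.
  have k0 : 0 < k.+1%:R^-1 :> R by rewrite invr_gt0.
  move=> /(_ x k _ k0)[n nok' gn]; apply: nok'; exists g => // j /gn.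
  exact: ltW.
(* The best available precision is taken for each [n]: a functional close at
   stage [k] is also close at all earlier stages. *)
have Mn n m : exists2 g, limsup_dominated g &
    forall k, (k <= m)%N -> ok n k -> close n k g.
  elim: m => [|m [g gL IHm]].
    exists \0 => [y c N yc|k].
      rewrite real_norm0; apply: le_trans (yc _ (leqnn N)).
      exact: real_norm_ge0.
    by rewrite leqn0 => /eqP -> _ j.
  have [[h hL hm]|nok] := pselect (ok n m.+1); last first.
    by exists g => // k; rewrite leq_eqVlt => /predU1P[->//|/IHm].
  exists h => // k km _ j jk; apply: le_trans (hm j (leq_trans jk km)) _.
  by rewrite lef_pV2 ?posrE// ler_nat ltnS.
have [n|M MP] := @choice _ _ (fun n g => limsup_dominated g /\
    forall k, (k <= n)%N -> ok n k -> close n k g).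
  by have [g] := Mn n n; exists g.
exists M => [n|j]; first by case: (MP n).
apply/null_seqE => e e0.
pose k := maxn j.+1 (Num.truncn e^-1).
have ke : k.+1%:R^-1 <= e.
  rewrite -[e]invrK lef_pV2 ?posrE// ?invr_gt0//.
  apply: (le_trans (ltW (truncnS_gt _))).
  by rewrite ler_nat ltnS leq_maxr.
have [N Nok] := okev k; exists (maxn N k) => n; rewrite geq_max => /andP[Nn kn].
apply: le_trans ke; have [_ /(_ _ kn (Nok _ Nn))] := MP n; apply.
exact: leq_maxl.
Qed.

End correction.

(** * Finiteness of the constant for bounded maps *)

Section K_constants.
Context {R : realType} {s : scalars}.
Local Notation K := (scalar_field R s).
Context {X : normedModType K}.

Section target.
Context {Y : normedModType K}.
Implicit Types F G : X -> Y.

Lemma map_normP G c : homogeneous G -> 0 <= c ->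
  (map_norm G <= c%:E)%E <-> norm_bounded c G.
Proof.
move=> Gh c0; split=> [Gc x|Gc]; last first.
  apply: ge_ereal_sup => _ [x /= x1 <-]; rewrite lee_fin.
  apply: (le_trans (Gc x)); rewrite -[leRHS]mulr1 ler_wpM2l//.
have [->|/eqP/real_norm_gt0 x0] := eqVneq x 0.
  by rewrite -(scale0r (0 : X)) Gh !scale0r !real_norm0 mulr0.
set r := real_norm x; have r0 : r != 0 by rewrite gt_eqF.
have xE : x = of_real s r *: (of_real s r^-1 *: x).
  by rewrite scalerA -of_realM divff// of_real1 scale1r.
rewrite {1}xE Gh real_norm_of_realZ gtr0_norm// mulrC ler_pM2r//.
rewrite -lee_fin; apply: le_trans Gc; apply: ereal_sup_ubound.
exists (of_real s r^-1 *: x) => //=.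
by rewrite real_norm_of_realZ gtr0_norm ?invr_gt0// mulVf.
Qed.

Lemma bounded_mapP F : bounded_map F ->
  exists2 c, 0 <= c & norm_bounded c F.
Proof.
move=> [Fh Fb].
have F0 : (0 <= map_norm F)%E.
  apply: (@le_trans _ _ (real_norm (F 0))%:E).
    by rewrite lee_fin real_norm_ge0.
  by apply: ereal_sup_ubound; exists 0 => //=; rewrite real_norm0.
exists (fine (map_norm F)); first exact: fine_ge0.
apply/map_normP; [exact: Fh|exact: fine_ge0|].
by rewrite fineK// ge0_fin_numE.
Qed.

Lemma homogeneousB F (M : {linear X -> Y}) : homogeneous F ->
  homogeneous (F \- M).
Proof. by move=> Fh a x; rewrite /= Fh linearZ /= scalerBr. Qed.

Lemma quasilinear_const_ge0 F : 0 <= quasilinear_const F.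
Proof.
rewrite /quasilinear_const; set S := [set Q | _].
have [->|/set0P S0] := eqVneq S set0; first by rewrite inf0.
by apply: lb_le_inf => // Q [].
Qed.

End target.

Lemma quasilinear_const_le (Y Z : normedModType K) (F : X -> Y) (G : X -> Z) :
  quasilinear F -> (forall Q, quasilinear_with F Q -> quasilinear_with G Q) ->
  quasilinear_const G <= quasilinear_const F.
Proof.
move=> [_ [Q FQ]] FG; apply: lb_le_inf.
  exists (Num.max Q 0); split; first by rewrite le_max lexx orbT.
  move=> x y; apply: (le_trans (FQ x y)).
  by rewrite ler_wpM2r ?addr_ge0 ?real_norm_ge0// le_max lexx.
move=> r [r0 /FG Gr]; apply: ge_inf => //.
by exists 0 => t [].
Qed.

Lemma real_norm_c0 (u : c0 R s) : real_norm u = c0_sup u.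
Proof. exact: of_realK. Qed.

Lemma real_norm_c0_le (u : c0 R s) (M : R) :
  (forall n, real_norm (u n : K^o) <= M) -> real_norm u <= M.
Proof. by move=> uM; rewrite real_norm_c0; exact: c0_sup_le. Qed.

Lemma real_norm_c0_ge (u : c0 R s) n : real_norm (u n : K^o) <= real_norm u.
Proof. by rewrite real_norm_c0; exact: c0_sup_ub. Qed.

Lemma K_space_linear_near : K_space X -> exists2 C : R, 0 <= C &
  forall f : X -> K^o, quasilinear f -> linearly_approximable C f.
Proof. by move=> /ereal_inf_lt[_ [C [C0 CP] <-] _]; exists C. Qed.

(** Write [F] as the sequence of its coordinates [f n]. Since [X] is a
    K-space, [f n] is within [C * Q] of a linear [L n], and the [L n] are
    uniformly bounded because [F] is bounded. As [F x] tends to zero, the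
    upper limit of [real_norm (L n x)] is at most [C * Q * real_norm x], and
    this bound passes to functionals [M n] such that [L n - M n] tends to zero
    on a countable set, which is chosen so that it tends to zero everywhere.
    Thus [x |-> (L n x - M n x)] is a linear map into [c0], at distance at
    most [2 * C * Q] from [F]. *)
Lemma K0_const_c0_finite : weakly_compactly_generated X -> K_space X ->
  (K0_const X (c0 R s) < +oo)%E.
Proof.
move=> [W [Wc Wd]] /K_space_linear_near[C C_ge0 CP].
apply: (@le_lt_trans _ _ (2 * C)%:E); last exact: ltry.
apply: ereal_inf_lbound; exists (2 * C) => //; split; first by rewrite mulr_ge0.
move=> F Fb Fq; have [c _ Fc] := bounded_mapP Fb.
set Q := quasilinear_const F; have Q0 : 0 <= Q by exact: quasilinear_const_ge0.
pose f n : X -> K^o := fun x => F x n.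
have fh n : homogeneous (f n) by move=> a x; rewrite /f Fq.1.
have fQ n q : quasilinear_with F q -> quasilinear_with (f n) q.
  move=> Fq' x y; apply: le_trans (Fq' x y).
  exact: (real_norm_c0_ge (F (x + y) - F x - F y)).
have CQ0 : 0 <= C * Q by rewrite mulr_ge0.
have Ln n : exists L : {linear X -> K^o}, norm_bounded (C * Q) (f n \- L).
  have [|L LP] := CP (f n).
    by split=> //; have [_ [q Fq']] := Fq; exists q; exact: fQ.
  exists L; apply/map_normP => //; first exact: homogeneousB.
  apply: le_trans LP _; rewrite lee_fin ler_wpM2l//.
  by apply: quasilinear_const_le Fq _ => q; exact: fQ.
have [L LP] := choice Ln.
have Lb n : norm_bounded (c + C * Q) (L n).
  move=> x; have := real_normB (f n x) (f n x - L n x).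
  rewrite opprB addrC subrK mulrDl => /le_trans; apply; apply: lerD.
    exact: le_trans (real_norm_c0_ge _ _) (Fc x).
  exact: LP.
have [D [Dc DW Dapp]] := countable_approximates W L.
have [e De] := countable_sub_range (0 : X) Dc.
have [|M Mdom Mnull] := @null_correction R s X L _ e.
  by move=> x; exists ((c + C * Q) * real_norm x) => n; exact: Lb.
have Mb n : norm_bounded (C * Q) (M n).
  move=> x; apply/ler_addgt0Pr => d d0.
  have /null_seqE/(_ d d0)[N FN] := c0_valP (F x).
  apply: (Mdom n x _ N) => m Nm.
  have := real_normB (f m x) (f m x - L m x).
  rewrite opprB addrC subrK => /le_trans; apply.
  by rewrite [leLHS]addrC; apply: lerD; [exact: LP|exact: FN].
have LMlin n : linear (fun x => L n x - M n x : K^o).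
  by move=> a x y; rewrite !linearP scalerBr addrACA -scalerN.
have [h hE] := choice (fun n => bundle_linear (LMlin n)).
have hnull x : (fun n => L n x - M n x) \in @null_seq R s.
  have <- : h^~ x = (fun n => L n x - M n x) by apply/funext => n.
  apply: (null_on_generated (c := c + C * Q + C * Q) Wc Wd DW _ Dapp).
  - by move=> i; exists (c + C * Q).
  - move=> n y; rewrite hE mulrDl; apply: le_trans (real_normB _ _) _.
    by apply: lerD; [exact: Lb|exact: Mb].
  - move=> y Ly n; rewrite hE Ly sub0r.
    suff -> : M n y = 0 by rewrite oppr0.
    apply: real_norm0_eq0; apply/eqP; rewrite eq_le real_norm_ge0 andbT.
    by apply: (Mdom n y 0 0%N) => m _; rewrite Ly real_norm0.
  - move=> d /De[j _ <-].
    have -> // : h^~ (e j) = (fun n => L n (e j) - M n (e j)).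
    by apply/funext => n.
pose T x : c0 R s := C0 (hnull x).
have Tlin : linear T.
  move=> a x y; apply/val_inj/funext => n.
  by rewrite -[LHS]/(L n (a *: x + y) - M n (a *: x + y)) -hE linearP !hE.
have [T' T'E] := bundle_linear Tlin; exists T'.
apply/map_normP; [exact: homogeneousB Fq.1|by rewrite mulr_ge0// mulr_ge0|].
move=> x; apply: real_norm_c0_le => n; rewrite -[(F \- T') x]/(F x - T' x) T'E.
have -> : (F x - T x) n = f n x - L n x + M n x :> K^o 
  by rewrite -[LHS]/(F x n - (L n x - M n x)) opprB addrCA addrC.
have -> : 2 * C * Q * real_norm x = C * Q * real_norm x + C * Q * real_norm x.
  by ring.
apply: le_trans (real_normD _ _) _.
by apply: lerD; [exact: LP|exact: Mb].
Qed.

End K_constants.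

(** * An uncountable family of functionals vanishing at infinity *)

Section well_orders.
Variable T : Type.
Implicit Types (lt : T -> T -> Prop) (A J : set T).

Definition well_order_lt lt := (forall x y, lt x y -> ~ lt y x) /\
  forall A, A !=set0 -> exists2 m, A m & forall y, A y -> y = m \/ lt m y.

Lemma well_order_lt_wf lt : well_order_lt lt -> well_founded lt.
Proof.
move=> [asym ltmin] x; apply: contrapT => xN.
have [|m mN mmin] := ltmin [set x | ~ Acc lt x]; first by exists x.
apply: mN; constructor => y ym; apply: contrapT => /mmin[yE|/asym//].
by move: (asym _ _ ym); rewrite yE in ym *.
Qed.

(** A set [J] of order type omega_1 inside a well-ordered uncountable type:
    the smallest initial segment which is uncountable, or the whole type. *)
Lemma uncountable_well_order : ~ countable [set: T] ->
  exists lt J, [/\ well_order_lt lt, ~ countable J &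
    forall x, J x -> countable [set y | lt y x]].
Proof.
move=> Tunc; have [r rwo] := well_ordering_principle {classic T}.
pose lt (x y : T) := r x y /\ x <> y.
have rmin A : A !=set0 -> exists2 m, A m & forall y, A y -> r m y.
  move=> [x Ax]; have [|m [[mA mmin] _]] := rwo (fun x => `[< A x >]).
    by exists x; apply/asboolP.
  by exists m => [|y Ay]; [exact/asboolP|apply/mmin/asboolP].
have ltwo : well_order_lt lt.
  split=> [x y [xy nxy] [yx _]|A /rmin[m Am mmin]].
    apply: nxy; have rch : wo_chain r predT by move=> C _; exact: rwo.
    by apply: (wo_chain_antisymmetric rch); rewrite ?inE ?xy ?yx.
  exists m => // y Ay; have [->|ym] := pselect (y = m); first by left.
  by right; split; [exact: mmin|exact/nesym].
exists lt; have [allc|] :=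
    pselect (forall x, countable [set y | lt y x]); first by exists setT.
move=> /existsNP nc; have [_ /(_ _ nc)[x0 x0N x0min]] := ltwo.
exists [set y | lt y x0]; split=> // y yx0; apply: contrapT => /x0min.
case=> [yx|xy]; last exact: (ltwo.1 _ _ yx0 xy).
by rewrite yx in yx0; case: yx0.
Qed.

(** Repeatedly jump to an index which minimises [a] on a tail. *)
Lemma increasing_subsequence lt (a : nat -> T) : well_order_lt lt ->
  injective a ->
  exists phi : nat -> nat, forall i j, (i < j)%N -> lt (a (phi i)) (a (phi j)).
Proof.
move=> [_ ltmin] ainj.
have mP N : exists n, (N <= n)%N /\ forall j, (N <= j)%N ->
    j = n \/ lt (a n) (a j).
  have [|_ [n Nn <-] nmin] := ltmin (a @` [set n | (N <= n)%N]).
    by exists (a N), N => /=.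
  exists n; split=> // j Nj.
  by have [|/ainj|] := nmin (a j); [exists j|left|right].
have [m {}mP] := choice mP.
pose phi k := iter k (fun n => m n.+1) (m 0%N).
have phiS k : (phi k < phi k.+1)%N by have [] := mP (phi k).+1.
have phi_lt : {homo phi : i j / (i < j)%N} by exact: homo_ltn ltn_trans phiS.
exists phi => i j ij; have ij' := phi_lt _ _ ij.
have [N phiE] : exists N, phi i = m N.
  by case: (i) => [|k]; [exists 0%N|exists (phi k).+1].
have [Ni /(_ (phi j))] := mP N; rewrite -phiE in Ni *.
case=> [|jE|//]; first exact: leq_trans Ni (ltnW ij').
by rewrite jE ltnn in ij'.
Qed.

End well_orders.

Lemma In_mkseq (T : Type) (h : nat -> T) k g :
  List.In g (mkseq h k) <-> exists2 i, (i < k)%N & h i = g.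
Proof.
suff gen m : List.In g (map h (iota m k)) <->
    exists2 i, (m <= i < m + k)%N & h i = g by exact: gen.
elim: k m => [|k IHk] m /=.
  by split=> [//|[j]]; rewrite addn0; case: ltngtP.
rewrite addnS -addSn; split=> [[<-|/IHk[i /andP[mi ik] <-]]|[i /andP[]]].
- by exists m; rewrite // leqnn leq_addr.
- by exists i; rewrite // (ltnW mi).
rewrite leq_eqVlt => /predU1P[<- _ ->|mi ik ig]; first by left.
by right; apply/IHk; exists i; rewrite ?mi.
Qed.

Section small_families.
Context {R : realType} {s : scalars}.
Local Notation K := (scalar_field R s).
Context {X : normedModType K}.

(** By recursion on the well-order, for [a] in the uncountable set [J] of
    indices with countably many predecessors, [f a] is a nonzero functional
    that vanishes on a countable net of [W] for each finite list of
    functionals chosen before it; it exists since [X] is nonseparable. If some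
    [x] had infinitely many large values, there would be an increasing
    sequence of such indices; the union of the nets of its initial segments is
    approximating for these functionals, and each of its points is killed by
    all but finitely many of them, so that they tend to zero at [x] by
    [null_on_generated]. *)
Lemma small_uncountable_family (T : pointedType) (W : set X) :
  weakly_compact W -> dense (linear_span W) -> ~ separable_space X ->
  ~ countable [set: T] ->
  exists f : T -> {linear X -> K^o},
    [/\ forall a, norm_bounded 1 (f a),
        ~ countable [set a | exists x, f a x <> 0] &
        forall x (e : R), 0 < e -> finite_set [set a | e < real_norm (f a x)]].
Proof.
move=> Wc Wd Xns /uncountable_well_order[lt [J [ltwo Junc Jc]]].
have [net netP] := choice (countable_net W).
pose killed (C : set {linear X -> K^o}) :=
  \bigcup_(l in [set l | forall g, List.In g l -> C g]) net l.
pose good C := [set g : {linear X -> K^o} | [/\ norm_bounded 1 g,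
  forall d, killed C d -> g d = 0 & exists x, g x <> 0]].
have goodP C : exists g, countable C -> good C g.
  have [Cc|Cunc] := pselect (countable C); last by exists \0.
  suff [g gC] : exists g, good C g by exists g.
  apply: nonseparable_annihilator Xns _.
  apply: bigcup_countable; first exact: countable_lists.
  by move=> l _; case: (netP l).
have [select selectP] := choice goodP.
pose step (a : T) (rec : forall b, lt b a -> {linear X -> K^o}) :=
  select [set g | exists b (ba : lt b a), rec b ba = g].
pose f := Fix (well_order_lt_wf ltwo) (fun _ => {linear X -> K^o}) step.
have fE a : f a = select (f @` [set b | lt b a]).
  rewrite /f Fix_eq -/f; last first.
    move=> x g h gh; congr (step x _).
    by apply: functional_extensionality_dep => y; exact/funext.
  congr select; apply/seteqP; split=> [_ [b [ba <-]]|_ [b ba <-]].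
    by exists b.
  by exists b, ba.
have fgood a : J a -> good (f @` [set b | lt b a]) (f a).
  move=> Ja; rewrite fE; apply: selectP.
  exact: card_le_trans (card_image_le _ _) (Jc _ Ja).
(* Outside [J] the recursion step has no functional to choose. *)
pose F a : {linear X -> K^o} := if `[< J a >] then f a else \0.
exists F; split=> [a x||x e e0].
- rewrite /F; case: asboolP => [/fgood[+ _ _]|_]; first exact.
  by rewrite real_norm0 mul1r real_norm_ge0.
- apply: contra_not Junc; apply: countable_subset => a Ja /=.
  by rewrite /F asboolT//; have [] := fgood _ Ja.
apply: contrapT => /infiniteP/pcard_leP[a].
have aP n : J (a n) /\ e < real_norm (f (a n) x).
  have : [set a | e < real_norm (F a x)] (a n) by exact: funS.
  rewrite /= /F; case: asboolP => // _.
  by rewrite real_norm0 ltNge ltW.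
have ainj : injective a by move=> i j; apply: inj; rewrite inE.
have [phi phiP] := increasing_subsequence ltwo ainj.
pose h i := f (a (phi i)).
pose D := \bigcup_k net (mkseq h k).
have : (fun i => h i x) \in @null_seq R s.
  apply: (@null_on_generated R s X W D h h 1 Wc Wd).
  - by move=> d [k _]; have [_ + _] := netP (mkseq h k); apply.
  - by move=> i; exists 1; have [hi _ _] := fgood _ (aP (phi i)).1.
  - move=> k w d Ww d0; have [_ _ /(_ w d Ww d0)[v vD vP]] := netP (mkseq h k).
    exists v => [|i ik]; first by exists k.
    by apply/vP/In_mkseq; exists i.
  - by move=> i; have [hi _ _] := fgood _ (aP (phi i)).1.
  - by [].
  - move=> d [k _ dk]; apply/null_seqE => r r0; exists k => i ki.
    have [_ + _] := fgood _ (aP (phi i)).1; rewrite /h => ->.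
      by rewrite real_norm0 ltW.
    exists (mkseq h k) => //= g.
    move=> /In_mkseq[j jk <-]; exists (a (phi j)) => //=.
    by apply: phiP; exact: leq_trans jk ki.
move=> /null_seqE/(_ _ e0)[N /(_ N (leqnn N))].
by rewrite leNgt (aP _).2.
Qed.

End small_families.

(** * Gluing functionals along almost disjoint sets *)

Section branches.
Local Notation branch := (nat -> bool).

(** The branches of the dyadic tree are a family of the size of the continuum
    of infinite sets of integers, any two of which have a finite intersection. *)
Definition nodes (a : branch) : set nat := range (fun k => pickle (mkseq a k)).

Lemma nodes_unbounded a N : exists2 n, (N <= n)%N & nodes a n.
Proof.
pose u k := pickle (mkseq a k).
have uinj : injective u.
  move=> i j /(pcan_inj pickleK)/(congr1 size).
  by rewrite !size_mkseq.
apply: contrapT => uN.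
have sub : {subset map u (iota 0 N.+1) <= iota 0 N}.
  move=> _ /mapP[k _ ->]; rewrite mem_iota add0n ltnNge /=.
  by apply/negP => Nu; apply: uN; exists (u k) => //; exists k.
have := uniq_leq_size _ sub.
rewrite map_inj_uniq// iota_uniq size_map !size_iota.
by rewrite ltnn => /(_ isT).
Qed.

Lemma nodes_almost_disjoint a b : a <> b ->
  exists N, forall n, (N <= n)%N -> nodes a n -> ~ nodes b n.
Proof.
move=> ab; have [i abi] : exists i, a i <> b i.
  by apply/existsNP => abE; apply: ab; exact/funext.
exists (\sum_(k < i.+1) pickle (mkseq a k)).+1 => n ki [k _ kn].
rewrite -{}kn in ki * => -[l _ /(pcan_inj pickleK) blE].
have lk : l = k by have := congr1 size blE; rewrite !size_mkseq.
rewrite {}lk in blE; have [ik|ki'] := ltnP i k.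
  apply: abi; have := congr1 (nth false ^~ i) blE.
  by rewrite !nth_mkseq.
move: ki; rewrite (bigD1 (Ordinal (ki' : (k < i.+1)%N)))//= ltnNge.
by rewrite leq_addr.
Qed.

End branches.

Lemma eventually_all_finite (T : Type) (G : set T) (P : T -> nat -> Prop) :
  finite_set G ->
  (forall g, G g -> exists N, forall n, (N <= n)%N -> P g n) ->
  exists N, forall n, (N <= n)%N -> forall g, G g -> P g n.
Proof.
elim/Peq : T => T in G P *.
move=> /finite_seqP[l ->]; elim: l => [|g l IHl] GP; first by exists 0%N.
have [|N NP] := IHl; first by move=> h hl; apply: GP; rewrite /= inE hl orbT.
have [|M MP] := GP g; first by rewrite /= inE eqxx.
exists (maxn N M) => n; rewrite geq_max => /andP[Nn Mn] h /=.
by rewrite inE => /predU1P[->|]; [exact: MP|exact: NP].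
Qed.

(** An algebraic, necessarily discontinuous, projection. *)
Lemma null_seq_projection (R : realType) (s : scalars) :
  exists P : {linear (nat -> scalar_field R s) -> c0 R s},
    forall u : c0 R s, P (c0_val u) = u.
Proof.
pose K := scalar_field R s.
pose G0 := [set (c0_val u : nat -> K, u) | u in [set: c0 R s]].
have [|//|G _ _ v|P [_ PG]] :=
    @linear_extension K (nat -> K) (c0 R s) G0 setT.
- split; first by exists 0.
    by move=> a _ _ [u _ <-] [v _ <-]; exists (a *: u + v).
  by move=> _ [u _ [u0 <-]]; apply: val_inj.
- by exists 0.
by exists P => u; apply: PG; exists u.
Qed.

Section glued_functionals.
Context {R : realType} {s : scalars}.
Local Notation K := (scalar_field R s).
Context {X : normedModType K}.
Variable f : (nat -> bool) -> {linear X -> K^o}.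
Hypothesis f1 : forall a, norm_bounded 1 (f a).
Hypothesis ffin : forall x (e : R), 0 < e ->
  finite_set [set a | e < real_norm (f a x)].

Let dominant (x : X) n := [set b | nodes b n /\
  forall c, nodes c n -> real_norm (f c x) <= 2 * real_norm (f b x)].

Let index (x : X) n := xget (fun _ => false) (dominant x n).

(** Modulo null sequences this is the sum over [a] of [f a x] times the
    indicator of the branch [a]. The terms that meet at a node are not added
    up: one of them is selected which is at least half as large as all the
    others. The set of admissible selections is the same for [x] and for its
    nonzero multiples, which makes [glued] exactly homogeneous; and the
    sequence is bounded by the norm of [x]. *)
Definition glued (x : X) : nat -> K := fun n =>
  if `[< nodes (index x n) n >] then f (index x n) x else 0.

Lemma gluedZ (l : K) x : glued (l *: x) = l *: glued x.
Proof.
apply/funext => n; rewrite -[RHS]/(l * glued x n) /glued.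
have [->|l0] := eqVneq l 0.
  by rewrite scale0r mul0r linear0; case: ifP.
suff -> : index (l *: x) n = index x n.
  by case: ifP => _; rewrite ?mulr0// linearZ.
congr xget; apply/seteqP.
have lgt0 : 0 < real_norm (l : K^o) by apply: real_norm_gt0; exact/eqP.
have domE b c : (real_norm (f c (l *: x)) <= 2 * real_norm (f b (l *: x))) =
    (real_norm (f c x) <= 2 * real_norm (f b x)).
  by rewrite !linearZ !real_normZ mulrCA ler_pM2l.
by split=> b [bn dom]; split=> // c /dom; rewrite domE.
Qed.

Lemma glued_bounded x n : real_norm (glued x n : K^o) <= real_norm x.
Proof.
rewrite /glued; case: ifP => _; last by rewrite real_norm0 real_norm_ge0.
by have := f1 (index x n) x; rewrite mul1r.
Qed.

(** Factor two, instead of a maximum, makes this a property of the supremum. *)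
Lemma dominant_neq0 x n a : nodes a n -> dominant x n !=set0.
Proof.
move=> an; pose S := [set real_norm (f b x) | b in nodes^~ n].
have Sub : has_ubound S.
  by exists (real_norm x) => _ [b _ <-]; have := f1 b x; rewrite mul1r.
have Ssup : has_sup S by split => //; exists (real_norm (f a x)), a.
have leS b : nodes b n -> real_norm (f b x) <= sup S.
  by move=> bn; apply: ub_le_sup => //; exists b.
have [S0|S0] := leP (sup S) 0.
  exists a; split=> // b /leS /le_trans-> //; apply: (le_trans S0).
  by rewrite mulr_ge0// real_norm_ge0.
have [|_ [b bn <-] Sb] := @sup_adherent _ S (sup S / 2) _ Ssup.
  by rewrite divr_gt0.
exists b; split=> // c /leS cS; have := cS; lra.
Qed.

Lemma glued_near x n b (e : R) : 0 <= e -> nodes b n ->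
  (forall c, nodes c n -> c <> b -> real_norm (f c x) <= e) ->
  real_norm (glued x n - f b x : K^o) <= 3 * e.
Proof.
move=> e0 bn be; have [i_n idom] : dominant x n (index x n).
  by apply: xgetPex; exact: dominant_neq0 bn.
rewrite /glued asboolT//.
have [->|/be ie] := pselect (index x n = b).
  by rewrite subrr real_norm0 mulr_ge0.
apply: (le_trans (real_normB _ _)).
by have := ie i_n; have := idom _ bn; lra.
Qed.

Lemma glued_small x n (e : R) : 0 <= e ->
  (forall c, nodes c n -> real_norm (f c x) <= e) ->
  real_norm (glued x n : K^o) <= e.
Proof.
move=> e0 fe; rewrite /glued; case: asboolP => [/fe//|_].
by rewrite real_norm0.
Qed.

Lemma nodes_separate (G : set (nat -> bool)) : finite_set G ->
  exists N, forall n, (N <= n)%N -> forall b c, G b -> G c ->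
    nodes b n -> nodes c n -> c = b.
Proof.
move=> Gfin; have [b Gb|N NP] :=
    @eventually_all_finite _ G (fun b n => forall c, G c ->
      nodes b n -> nodes c n -> c = b) Gfin.
  apply: (@eventually_all_finite _ G (fun c n =>
    nodes b n -> nodes c n -> c = b) Gfin) => c Gc.
  have [->|/nesym/nodes_almost_disjoint[N bcN]] := pselect (c = b).
    by exists 0%N.
  by exists N => n /bcN bcn /bcn.
by exists N => n /NP nP b c /nP; exact.
Qed.

Lemma glued_branch x a (e : R) : 0 < e -> exists N, forall n, (N <= n)%N ->
  nodes a n -> real_norm (glued x n - f a x : K^o) <= e.
Proof.
move=> e0; have e30 : 0 < e / 3 by rewrite divr_gt0.
have [|N NP] :=
    @nodes_separate ([set b | e / 3 < real_norm (f b x)] `|` [set a]).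
  by rewrite finite_setU; split; [exact: ffin|exact: finite_set1].
exists N => n Nn an; have -> : e = 3 * (e / 3) by rewrite mulrC divfK.
apply: glued_near => // [|c cn ca]; first exact: ltW.
rewrite leNgt; apply/negP => ec; apply: ca.
by apply: (NP n Nn a c) => //; [right|left].
Qed.

(** Far enough in the tree, a node lies on at most one of the finitely many
    branches where [x], [y] or [x + y] have a large value, and the three
    selections agree there with this branch up to a small error. *)
Lemma glued_additive x y :
  (fun n => glued (x + y) n - glued x n - glued y n) \in @null_seq R s.
Proof.
apply/null_seqE => e e0; pose d := e / 9.
have d0 : 0 < d by rewrite divr_gt0.
pose big z := [set b | d < real_norm (f b z)].
have bigfin : finite_set (big x `|` big y `|` big (x + y)).
  by rewrite !finite_setU; split; [split|]; exact: ffin.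
have [N NP] := nodes_separate bigfin.
exists N => n Nn.
have eE : e = 3 * d + 3 * d + 3 * d by rewrite /d; field.
have [[b [bn Gb]]|nb] := pselect (exists b, nodes b n /\
    (big x `|` big y `|` big (x + y)) b).
  have near z : big z `<=` big x `|` big y `|` big (x + y) ->
      real_norm (glued z n - f b z : K^o) <= 3 * d.
    move=> zG; apply: glued_near => // [|c cn cb]; first exact: ltW.
    rewrite leNgt; apply/negP => dc; apply: cb.
    by apply: (NP n Nn b c) => //; exact: zG.
  have -> : glued (x + y) n - glued x n - glued y n =
      (glued (x + y) n - f b (x + y)) - (glued x n - f b x)
      - (glued y n - f b y).
    by rewrite linearD; ring.
  rewrite eE; apply: le_trans (real_normB _ _) _; apply: lerD.
    apply: le_trans (real_normB _ _) _.
    by apply: lerD; apply: near => c; [right|left; left].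
  by apply: near => c; left; right.
have small z : big z `<=` big x `|` big y `|` big (x + y) ->
    real_norm (glued z n : K^o) <= 3 * d.
  move=> zG; apply: (@le_trans _ _ d); last by lra.
  apply: glued_small => [|c cn]; first exact: ltW.
  rewrite leNgt; apply/negP => dc; apply: nb.
  by exists c; split => //; exact: zG.
rewrite eE; apply: le_trans (real_normB _ _) _; apply: lerD.
  apply: le_trans (real_normB _ _) _.
  by apply: lerD; apply: small => c; [right|left; left].
by apply: small => c; left; right.
Qed.

End glued_functionals.

(** * Infiniteness of the unrestricted constant *)

Lemma cantor_uncountable : ~ countable [set: nat -> bool].
Proof.
move=> /(countable_sub_range (fun _ => false))[u uT].
have [n _ un] := uT (fun n => ~~ u n n) I.
by have := congr1 (@^~ n) un; case: (u n n).
Qed.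

(** Let [B] glue the functionals of [small_uncountable_family] and [P] project
    all sequences onto [c0]. As [B] is additive modulo [c0], the map [P \o B]
    is quasilinear and [B - P \o B] is linear. If [L] is linear at finite
    distance from [P \o B], then [T = B - P \o B + L] is a bounded linear map
    into the bounded sequences that differs from [B] by null sequences, and
    along the branch [a] the sequence [T x] tends to [f a x]. A countable set
    [D] is approximating for the coordinates of [T]; some nonzero [f a]
    vanishes on it, since each point of [D] is killed by all but countably
    many [f a]. Then [T x] tends to zero along the branch [a] for [x] in [D],
    hence for all [x], so [f a = 0]. *)
Lemma K_const_c0_infinite (R : realType) (s : scalars)
    (X : normedModType (scalar_field R s)) :
  weakly_compactly_generated X -> ~ separable_space X ->
  K_const X (c0 R s) = +oo%E.
Proof.
pose K := scalar_field R s.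
move=> [W [Wc Wd]] Xns.
have [f [f1 func ffin]] :=
  small_uncountable_family Wc Wd Xns cantor_uncountable.
have [P Pid] := null_seq_projection R s.
pose B := glued f.
pose F (x : X) : c0 R s := P (B x).
have Fh : homogeneous F by move=> l x; rewrite /F /B gluedZ linearZ.
have BF x y : c0_val (F (x + y) - F x - F y) =
    (fun n => B (x + y) n - B x n - B y n).
  rewrite /F -!linearB.
  have Bnull := glued_additive f1 ffin x y.
  by rewrite -[B _ - _ - _]/(c0_val (C0 Bnull)) Pid.
have Fq : quasilinear F.
  split=> //; exists 2 => x y; apply: real_norm_c0_le => n.
  rewrite [_ n](congr1 (@^~ n) (BF x y)).
  apply: le_trans (real_normB _ _) _.
  have := real_normB (B (x + y) n : K^o) (B x n).
  have := glued_bounded f1 (x + y) n; have := glued_bounded f1 x n.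
  have := glued_bounded f1 y n; have := real_normD x y.
  rewrite -/B; lra.
apply/eqP; rewrite eq_le leey /=; apply/ereal_infP => _ [C [C0 CP] <-].
exfalso; have [L LF] := CP F Fq.
pose c := C * quasilinear_const F.
have FL : norm_bounded c (F \- L).
  apply/map_normP; last exact: LF; first exact: homogeneousB.
  by rewrite mulr_ge0// quasilinear_const_ge0.
have Tlin n : linear (fun x => B x n - (F x - L x) n : K^o).
  move=> a x y.
  have FB : F (a *: x + y) n - a * F x n - F y n =
      B (a *: x + y) n - a * B x n - B y n :> K.
    by have := congr1 (@^~ n) (BF (a *: x) y); rewrite Fh /B gluedZ.
  have {}FB : F (a *: x + y) n =
      B (a *: x + y) n - a * B x n - B y n + a * F x n + F y n :> K.
    by rewrite -FB; ring.
  rewrite linearP -[LHS]/(B (a *: x + y) n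
    - (F (a *: x + y) n - (a * L x n + L y n))) FB.
  rewrite -[RHS]/(a * (B x n - (F x n - L x n)) + (B y n - (F y n - L y n))).
  by ring.
have [T TE] := choice (fun n => bundle_linear (Tlin n)).
have Tb n : norm_bounded (1 + c) (T n).
  move=> x; rewrite TE mulrDl mul1r; apply: le_trans (real_normB _ _) _.
  apply: lerD; first exact: glued_bounded.
  exact: le_trans (real_norm_c0_ge _ _) (FL x).
have [D [Dc DW Dapp]] := countable_approximates W T.
have [a [x fax] fad] : exists2 a, exists x, f a x <> 0 &
    forall d, D d -> f a d = 0.
  apply: contrapT => noa; apply: func.
  apply: (@countable_subset _ _ (\bigcup_(d in D) \bigcup_k
      [set a | k.+1%:R^-1 < real_norm (f a d)])) => [a fa|]; last first.
    apply: bigcup_countable => // d _; apply: bigcup_countable => // k _.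
    by apply/finite_set_countable/ffin; rewrite invr_gt0.
  apply: contrapT => aD; apply: noa; exists a => // d Dd.
  apply: contrapT => /real_norm_gt0 fad; apply: aD; exists d => //.
  exists (Num.truncn (real_norm (f a d))^-1) => //=.
  by rewrite -[ltRHS]invrK ltf_pV2 ?posrE ?invr_gt0// truncnS_gt.
(* The coordinates of [T] along the branch [a]. *)
pose h n : {linear X -> K^o} := if `[< nodes a n >] then T n else \0.
have hnull : h^~ x \in @null_seq R s.
  apply: (null_on_generated (c := 1 + c) Wc Wd DW _ Dapp).
  - by move=> n; exists (1 + c).
  - move=> n y; rewrite /h; case: asboolP => _; first exact: Tb.
    rewrite real_norm0 mulr_ge0 ?real_norm_ge0// addr_ge0// mulr_ge0//.
    exact: quasilinear_const_ge0.
  - by move=> y Ty n; rewrite /h; case: asboolP.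
  move=> d Dd; apply/null_seqE => e e0.
  have e20 : 0 < e / 2 by rewrite divr_gt0.
  have [N1 N1P] := glued_branch f1 ffin d a e20.
  have /null_seqE/(_ _ e20)[N2 N2P] := c0_valP (F d - L d).
  exists (maxn N1 N2) => n; rewrite geq_max => /andP[N1n N2n].
  rewrite /h; case: asboolP => an; last by rewrite real_norm0 ltW.
  rewrite TE [e]splitr; apply: le_trans (real_normB _ _) _; apply: lerD.
    by have := N1P n N1n an; rewrite fad// subr0.
  exact: N2P.
pose e := real_norm (f a x) / 4.
have e0 : 0 < e by rewrite divr_gt0// real_norm_gt0.
have /null_seqE/(_ _ e0)[N1 N1P] := hnull.
have [N2 N2P] := glued_branch f1 ffin x a e0.
have /null_seqE/(_ _ e0)[N3 N3P] := c0_valP (F x - L x).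
have [n + an] := nodes_unbounded a (maxn N1 (maxn N2 N3)).
rewrite !geq_max => /and3P[/N1P h1 /N2P/(_ an) h2 /N3P h3].
move: h1; rewrite /h asboolT// TE => h1.
have faE : f a x = (B x n - (F x - L x) n) + (F x - L x) n - (B x n - f a x).
  by rewrite subrK opprB addrC subrK.
have := real_normB ((B x n - (F x - L x) n) + (F x - L x) n : K^o)
  (B x n - f a x).
rewrite -faE; have := real_normD (B x n - (F x - L x) n : K^o) ((F x - L x) n).
move: e0 h1 h2 h3; rewrite /e /B; lra.
Qed.

Theorem mainTheorem3 (R : realType) (s : scalars)
    (X : completeNormedModType (scalar_field R s))
    (hX : weakly_compactly_generated X) :
  [/\ (~ separable_space X -> K_const X (c0 R s) = +oo%E),
      (K_space X -> (K0_const X (c0 R s) < +oo)%E)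
    & (~ separable_space X -> K_space X ->
         (K0_const X (c0 R s) < +oo)%E /\ K_const X (c0 R s) = +oo%E)].
Proof.
have infinite := @K_const_c0_infinite R s X hX.
have finite := @K0_const_c0_finite R s X hX.
by split=> // Xns XK; split; [exact: finite|exact: infinite].
Qed.
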